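(* Let $\alpha\in(0,\tfrac12)$ and let $\mathcal{L}\in\mathbb{R}^{n\times n}$ be a directed Laplacian with $m$ nonzero entries whose diagonal entries are all positive. Let $D=\mathrm{diag}(\mathcal{L})$ (the diagonal matrix with $D_{ii}=\mathcal{L}_{ii}$). Suppose we are given a procedure which, for any $\alpha$-RCDD Z-matrix $M\in\mathbb{R}^{n\times n}$ with $O(m)$ nonzero entries, any $b\in\mathbb{R}^n$, and any accuracy $\epsilon>0$ with $1/\epsilon=O(\mathrm{poly}(n/\alpha))$, returns a vector $x$ with $$\|x-M^{-1}b\|_{\mathrm{diag}(M)}\le \frac{\epsilon}{\alpha}\,\|b\|_{\mathrm{diag}(M)^{-1}}$$ in time $T$. Then there is an algorithm running in time $O((m+T)\log\alpha^{-1})$ that computes a vector $s\in\Delta^n$ such that, with $S=\mathrm{diag}(s)$, the matrix $(3\alpha n\cdot D+\mathcal{L})D^{-1}S$ is $\alpha$-RCDD. Furthermore, $\kappa(S)\le \frac{20}{\alpha^2}n$, and every $\alpha$-RCDD system passed to the procedure has a diagonal with condition number $O(\mathrm{poly}(n/\alpha))$.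
   Context: A directed Laplacian is a matrix $\mathcal{L}\in\mathbb{R}^{n\times n}$ with $\mathcal{L}_{ij}\le 0$ for all $i\ne j$ and $\vec 1^\top\mathcal{L}=\vec 0^\top$ (each column sums to zero). A Z-matrix is a matrix whose off-diagonal entries are all $\le 0$. For $\alpha\ge 0$, a matrix $A$ is $\alpha$-RCDD if $A_{ii}\ge(1+\alpha)\sum_{j\ne i}|A_{ij}|$ and $A_{ii}\ge(1+\alpha)\sum_{j\ne i}|A_{ji}|$ for all $i$. For a vector $x$, $\mathrm{diag}(x)$ is the diagonal matrix with $x$ on the diagonal; for a matrix $M$, $\mathrm{diag}(M)$ is $M$ with off-diagonal entries set to $0$. $\|x\|_{B}=\sqrt{x^\top Bx}$. $\Delta^n=\{x\in\mathbb{R}^n_{\ge0}:\vec 1^\top x=1\}$. For a nonzero diagonal matrix $S$, $\kappa(S)=\max_i|S_{ii}|/\min_i|S_{ii}|$. *)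

(* Defs.v *)
From HB Require Import structures.
From Stdlib Require List.
From mathcomp Require Import all_boot all_order all_algebra.
From mathcomp Require Import reals constructive_ereal exp.

Set Implicit Arguments.
Unset Strict Implicit.
Unset Printing Implicit Defensive.

Import Order.TTheory GRing.Theory Num.Theory.
Local Open Scope ring_scope.

Section Matrices.
Context {R : realType}.

Definition zmatrix n (A : 'M[R]_n) : Prop :=
  forall i j, i != j -> A i j <= 0.

Definition directed_laplacian n (L : 'M[R]_n) : Prop :=
  (forall i j, i != j -> L i j <= 0) /\ (const_mx 1 : 'rV[R]_n) *m L = 0.

Definition rcdd n (alpha : R) (A : 'M[R]_n) : Prop :=
  forall i, A i i >= (1 + alpha) * (\sum_(j | j != i) `|A i j|)
         /\ A i i >= (1 + alpha) * (\sum_(j | j != i) `|A j i|).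

Definition nnz n (A : 'M[R]_n) : nat := #|[set p : 'I_n * 'I_n | A p.1 p.2 != 0]|.

Definition diag_vec n (x : 'cV[R]_n) : 'M[R]_n := diag_mx x^T.

Definition diag_part n (M : 'M[R]_n) : 'M[R]_n := diag_mx (\row_i M i i).

Definition norm_wrt n (B : 'M[R]_n) (x : 'cV[R]_n) : R :=
  Num.sqrt ((x^T *m B *m x) 0 0).

Definition simplex n (x : 'cV[R]_n) : Prop :=
  (forall i, 0 <= x i 0) /\ \sum_i x i 0 = 1.

Definition max_diag n (S : 'M[R]_n) : R := \big[Num.max/0]_i `|S i i|.

(* Starting the minimum at the maximum is neutral as soon as n > 0. *)
Definition min_diag n (S : 'M[R]_n) : R := \big[Num.min/max_diag S]_i `|S i i|.

(* Extended-real valued: a diagonal with a zero entry has condition number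
   +oo, where division in R would give 0. *)
Definition kappa n (S : 'M[R]_n) : \bar R :=
  if min_diag S == 0 then +oo%E else (max_diag S / min_diag S)%:E.

End Matrices.

(* Sparse matrices, as lists of (row, column, value). *)
Section Sparse.
Context {R : realType}.

Definition coo : Type := seq (nat * nat * R).

Definition coo_mx n (es : coo) : 'M[R]_n :=
  \matrix_(i, j) \sum_(e <- es | (e.1.1 == i) && (e.1.2 == j)) e.2.

(* Under this condition, size es = nnz (coo_mx n es). *)
Definition coo_wf n (es : coo) : Prop :=
  [/\ uniq [seq e.1 | e <- es],
      all (fun e => (e.1.1 < n)%N && (e.1.2 < n)%N) es
    & all (fun e => e.2 != 0) es].

End Sparse.
Arguments coo : clear implicits.

(* The linear system solver handed to the algorithm: on a query (M, b, eps)
   it returns a vector together with the time it has taken. *)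
Section Solver.
Context {R : realType}.

Record query (n : nat) := Query {
  q_coo : coo R;
  q_rhs : 'cV[R]_n;
  q_eps : R }.

Definition q_mx n (q : query n) : 'M[R]_n := coo_mx n (q_coo q).

Definition procedure (n : nat) : Type := query n -> 'cV[R]_n * nat.

(* The queries on which the solver gives a guarantee, for matrices with at most
   N nonzero entries and 1/eps at most B. Invertibility of M is implicit in
   M^-1: the zero matrix, for instance, is an alpha-RCDD Z-matrix. *)
Definition admissible n (alpha : R) (N : nat) (B : R) (q : query n) : Prop :=
  [/\ coo_wf n (q_coo q),
      rcdd alpha (q_mx q) /\ zmatrix (q_mx q),
      q_mx q \in unitmx,
      (nnz (q_mx q) <= N)%N
    & 0 < q_eps q /\ (q_eps q)^-1 <= B].

Definition rcdd_solver n (alpha : R) (N : nat) (B : R) (T : nat)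
    (solve : procedure n) : Prop :=
  forall q, admissible alpha N B q ->
    norm_wrt (diag_part (q_mx q)) ((solve q).1 - invmx (q_mx q) *m q_rhs q)
      <= q_eps q / alpha * norm_wrt (invmx (diag_part (q_mx q))) (q_rhs q)
    /\ ((solve q).2 <= T)%N.

End Solver.
Arguments query : clear implicits.
Arguments procedure : clear implicits.

(* Real RAM. The memory consists of arrays of natural numbers (used as indices
   and counters) and arrays of real numbers; arrays are named by fixed numbers
   and indices may be computed, so that addressing is indirect. Programs are
   finite syntactic objects that mention no real constants other than natural
   numbers. Every elementary operation costs 1, and a call to the solver costs
   1 plus the time reported by the solver. There is no conversion between the
   two sorts, no multiplication of indices and no rounding. *)
Inductive iexp : Type :=
  | IConst of nat
  | IGet of nat & iexp
  | IAdd of iexp & iexp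
  | ISub of iexp & iexp.

Inductive rexp : Type :=
  | RConst of nat
  | RGet of nat & iexp
  | RAdd of rexp & rexp
  | RSub of rexp & rexp
  | RMul of rexp & rexp
  | RDiv of rexp & rexp.

Inductive bexp : Type :=
  | BILt of iexp & iexp
  | BRLt of rexp & rexp
  | BNot of bexp
  | BAnd of bexp & bexp.

Inductive cmd : Type :=
  | Skip
  | ISet of nat & iexp & iexp
  | RSet of nat & iexp & rexp
  | Seq of cmd & cmd
  | If of bexp & cmd & cmd
  | While of bexp & cmd
  | Call.

Fixpoint icost (e : iexp) : nat :=
  match e with
  | IConst _ => 1
  | IGet _ e => (icost e).+1
  | IAdd e f | ISub e f => (icost e + icost f).+1
  end%N.

Fixpoint rcost (e : rexp) : nat :=
  match e with
  | RConst _ => 1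
  | RGet _ e => (icost e).+1
  | RAdd e f | RSub e f | RMul e f | RDiv e f => (rcost e + rcost f).+1
  end%N.

Fixpoint bcost (b : bexp) : nat :=
  match b with
  | BILt e f => (icost e + icost f).+1
  | BRLt e f => (rcost e + rcost f).+1
  | BNot b => (bcost b).+1
  | BAnd b c => (bcost b + bcost c).+1
  end%N.

(* Memory layout: array names, with cell 0 of an array used for a scalar.
   All other arrays are scratch space. *)
Definition ia_size := 0%N.    (* input: cell 0 is n, cell 1 the number of entries *)
Definition ia_row := 1%N.     (* input: rows of the entries of the matrix *)
Definition ia_col := 2%N.     (* input: columns *)
Definition ia_qsize := 3%N.   (* query: cell 0 is the number of entries *)
Definition ia_qrow := 4%N.    (* query: rows *)
Definition ia_qcol := 5%N.    (* query: columns *)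
Definition ra_alpha := 0%N.   (* input: cell 0 is alpha *)
Definition ra_val := 1%N.     (* input: values of the entries of the matrix *)
Definition ra_qval := 2%N.    (* query: values *)
Definition ra_qrhs := 3%N.    (* query: right-hand side *)
Definition ra_qeps := 4%N.    (* query: cell 0 is the accuracy *)
Definition ra_answer := 5%N.  (* where the solver writes its answer *)
Definition ra_out := 6%N.     (* output vector *)

Section Semantics.
Context {R : realType}.

Record memory : Type := Memory {
  ints : nat -> nat -> nat;
  rls : nat -> nat -> R }.

Definition update (T : Type) (f : nat -> nat -> T) (a k : nat) (v : T) :=
  fun a' k' => if (a' == a) && (k' == k) then v else f a' k'.

Fixpoint ieval (s : memory) (e : iexp) : nat :=
  match e with
  | IConst k => k
  | IGet a e => ints s a (ieval s e)
  | IAdd e f => ieval s e + ieval s f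
  | ISub e f => ieval s e - ieval s f
  end%N.

Fixpoint reval (s : memory) (e : rexp) : R :=
  match e with
  | RConst k => k%:R
  | RGet a e => rls s a (ieval s e)
  | RAdd e f => reval s e + reval s f
  | RSub e f => reval s e - reval s f
  | RMul e f => reval s e * reval s f
  | RDiv e f => reval s e / reval s f
  end.

Fixpoint beval (s : memory) (b : bexp) : bool :=
  match b with
  | BILt e f => (ieval s e < ieval s f)%N
  | BRLt e f => reval s e < reval s f
  | BNot b => ~~ beval s b
  | BAnd b c => beval s b && beval s c
  end.

Definition read_vec n (s : memory) (a : nat) : 'cV[R]_n := \col_i rls s a i.

Definition write_vec n (s : memory) (a : nat) (x : 'cV[R]_n) : memory :=
  Memory (ints s) (fun a' k =>
    if a' == a then (if insub k is Some i then x i 0 else rls s a' k)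
    else rls s a' k).

Definition read_query n (s : memory) : query R n :=
  Query (mkseq (fun k => (ints s ia_qrow k, ints s ia_qcol k, rls s ra_qval k))
               (ints s ia_qsize 0%N))
        (read_vec n s ra_qrhs)
        (rls s ra_qeps 0%N).

(* exec solve c s s' t qs: started in s, the command c halts in s' after
   time t, and qs is the list of the queries made to the solver. *)
Inductive exec n (solve : procedure R n) :
    cmd -> memory -> memory -> nat -> seq (query R n) -> Prop :=
  | exec_skip s : exec solve Skip s s 1%N [::]
  | exec_iset s a e f :
      exec solve (ISet a e f) s
        (Memory (update (ints s) a (ieval s e) (ieval s f)) (rls s))
        (icost e + icost f).+1%N [::]
  | exec_rset s a e f :
      exec solve (RSet a e f) s
        (Memory (ints s) (update (rls s) a (ieval s e) (reval s f)))
        (icost e + rcost f).+1%N [::]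
  | exec_seq c d s s' s'' t u qs rs :
      exec solve c s s' t qs -> exec solve d s' s'' u rs ->
      exec solve (Seq c d) s s'' (t + u)%N (qs ++ rs)
  | exec_if b c d s s' t qs :
      exec solve (if beval s b then c else d) s s' t qs ->
      exec solve (If b c d) s s' (bcost b + t).+1%N qs
  | exec_while_stop b c s :
      ~~ beval s b -> exec solve (While b c) s s (bcost b).+1 [::]
  | exec_while_loop b c s s' s'' t u qs rs :
      beval s b ->
      exec solve c s s' t qs -> exec solve (While b c) s' s'' u rs ->
      exec solve (While b c) s s'' (bcost b + t + u).+1%N (qs ++ rs)
  | exec_call s :
      exec solve Call s
        (write_vec s ra_answer (solve (read_query n s)).1)
        (solve (read_query n s)).2.+1 [:: read_query n s].

(* The arrays not listed, and the cells beyond the lists, are filled with 0. *)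
Definition input n (es : coo R) (alpha : R) : memory :=
  Memory
    (fun a k => nth 0%N (nth [::] [:: [:: n; size es]; [seq e.1.1 | e <- es];
                                      [seq e.1.2 | e <- es]] a) k)
    (fun a k => nth 0 (nth [::] [:: [:: alpha]; [seq e.2 | e <- es]] a) k).

End Semantics.
Arguments memory : clear implicits.

(* Main.v *)
(** With [D] the diagonal of [L], write [L D^-1 = I - W] with [W] nonnegative
    and column stochastic. For a positive vector [x] let
    [e i = max alpha ((1 + alpha) (W x) i / x i - 1)], the least [e >= alpha]
    for which [(I + diag e - W) diag x] is [alpha]-RCDD. The algorithm starts
    from [x = 1], where [sum e = O(n)], and while [sum e > 3 alpha n] replaces
    [x] by an approximate solution [y] of [(I + diag e - W) y = e], obtained
    from the solver applied to the RCDD matrix [(I + diag e - W) diag x].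
    Summing the equation over its rows gives [sum_i e i * y i = sum_i e i], and
    [(W y) i / y i - 1 = e i (1 - 1 / y i) <= e i * y i / 4]; hence the new
    excess is at most about [(1 + alpha) / 4] times the old one plus [alpha n],
    and [O(log (1 / alpha))] rounds suffice. At the end every [e i] is at most
    [3 alpha n]. After the first round [x] is a near-solution for some
    [e >= alpha] with [sum e <= 3 n], so its entries stay between [alpha / 2] and [4 n / alpha],
    whence all bounds on condition numbers; errors do not accumulate because
    each round depends on the previous [x] only through [e]. *)
Require Import Defs.
From Stdlib Require List.
From mathcomp Require Import all_boot all_order all_algebra.
From mathcomp Require Import reals constructive_ereal exp.
From mathcomp Require Import ring lra zify.
Import Order.TTheory GRing.Theory Num.Theory.
Local Open Scope ring_scope.

(** * Excess of a vector and its decrease *)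

Section Iteration.
Context {R : realType} {n : nat} (alpha : R) (W : 'I_n -> 'I_n -> R).
Hypothesis alpha_itv : 0 < alpha < 1 / 2.
Hypothesis W_ge0 : forall i j, 0 <= W i j.
Hypothesis W_sum1 : forall j, \sum_i W i j = 1.

Definition excess (x : 'I_n -> R) (i : 'I_n) : R :=
  Num.max alpha ((1 + alpha) * (\sum_j W i j * x j) / x i - 1).

Lemma sum_stochastic (x : 'I_n -> R) :
  \sum_i \sum_j W i j * x j = \sum_j x j.
Proof.
rewrite exchange_big /=; apply: eq_bigr => j _.
by rewrite -mulr_suml W_sum1 mul1r.
Qed.

(** Summing the inequalities over [i], the unit column sums of [W] cancel [\sum_j a j] and leave
    [\sum_j e j * a j <= 0]. Both the nonnegativity of resolvents and the invertibility of the query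
    matrices come from this. *)
Lemma subinvariant_eq0 (e a : 'I_n -> R) :
  (forall i, 0 < e i) -> (forall i, 0 <= a i) ->
  (forall i, (1 + e i) * a i <= \sum_j W i j * a j) -> forall i, a i = 0.
Proof.
move=> e_gt0 a_ge0 le_a i.
have ea_ge0 j : true -> 0 <= e j * a j by rewrite mulr_ge0 // ltW.
have sum_le : \sum_j (1 + e j) * a j <= \sum_j a j.
  by rewrite -[leRHS]sum_stochastic; apply: ler_sum.
have sum0 : \sum_j e j * a j = 0.
  apply/eqP; rewrite eq_le sumr_ge0 // andbT.
  under eq_bigr => j _ do have -> : e j * a j = (1 + e j) * a j - a j by ring.
  by rewrite sumrB subr_le0.
by have /eqP := @psumr_eq0P _ _ _ _ ea_ge0 sum0 i isT; rewrite mulf_eq0 gt_eqF //= => /eqP.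
Qed.

Section Resolvent.
Context (e y : 'I_n -> R).
Hypothesis e_ge : forall i, alpha <= e i.
Hypothesis y_eq : forall i, (1 + e i) * y i - \sum_j W i j * y j = e i.

Let alpha_gt0 : 0 < alpha. Proof. by case/andP: alpha_itv. Qed.
Let e_gt0 i : 0 < e i. Proof. exact: lt_le_trans (e_ge i). Qed.

(** The negative part of [y] is subinvariant: where it is positive,
    [(1 + e i) * - y i = - (W y) i - e i], and dropping [e i] and the positive entries of [y] only
    enlarges the right side. *)
Lemma resolvent_ge0 i : 0 <= y i.
Proof.
pose a j := Num.max 0 (- y j).
have a_ge0 j : 0 <= a j by rewrite le_max lexx.
suff /(_ i) ai0 : forall j, a j = 0.
  by rewrite -oppr_le0 -[leRHS]ai0 /a le_max lexx orbT.
apply: (@subinvariant_eq0 e) => // j.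
have Wa_ge0 : 0 <= \sum_k W j k * a k by apply: sumr_ge0 => k _; apply: mulr_ge0.
rewrite {1}/a; have [yj|yj] := leP (- y j) 0; first by rewrite mulr0.
have -> : (1 + e j) * - y j = - (\sum_k W j k * y k) - e j.
  by rewrite -{2}(y_eq j); ring.
apply: (@le_trans _ _ (- (\sum_k W j k * y k))); first by have := e_gt0 j; lra.
rewrite -sumrN; apply: ler_sum => k _.
by rewrite -mulrN ler_wpM2l // le_max lexx orbT.
Qed.

Lemma resolvent_weighted_sum : \sum_i e i * y i = \sum_i e i.
Proof.
rewrite -[RHS](eq_bigr _ (fun i _ => y_eq i)) sumrB sum_stochastic -sumrB.
by apply: eq_bigr => i _; ring.
Qed.

(** As [W y >= 0], [y i] is at least [e i / (1 + e i)], hence at least [alpha / (1 + alpha)];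
    [alpha < 1 / 2] turns this into [2 / 3 * alpha]. *)
Lemma resolvent_ge i : 2 / 3 * alpha <= y i.
Proof.
have Wy_ge0 : 0 <= \sum_j W i j * y j.
  by apply: sumr_ge0 => j _; rewrite mulr_ge0 // resolvent_ge0.
have := y_eq i; have := e_ge i; case/andP: alpha_itv => a0 a1 ei yi.
have {yi} : e i <= (1 + e i) * y i by lra.
rewrite leNgt => h; rewrite leNgt; apply/negP => lty; case/negP: h.
apply: (@lt_trans _ _ ((1 + e i) * (2 / 3 * alpha))); last nra.
by rewrite ltr_pM2l //; lra.
Qed.

(** All terms of the conserved sum are nonnegative, and the [i]-th one is at least [alpha * y i]. *)
Lemma resolvent_le i : y i <= (\sum_j e j) / alpha.
Proof.
rewrite ler_pdivlMr // -resolvent_weighted_sum (bigD1 i) //=.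
apply: (@le_trans _ _ (e i * y i)).
  by rewrite mulrC ler_wpM2r // resolvent_ge0.
rewrite lerDl sumr_ge0 // => j _.
by rewrite mulr_ge0 ?resolvent_ge0 // ltW.
Qed.

Context (x : 'I_n -> R).
Hypothesis n_gt0 : (0 < n)%N.
Hypothesis e_le : \sum_j e j <= 3 * n%:R.
Hypothesis x_close : forall i, `|x i - y i| <= alpha ^+ 2 / (60 * n%:R).

Let n_ge1 : 1 <= n%:R :> R. Proof. by rewrite ler1n. Qed.

Let delta_le : alpha ^+ 2 / (60 * n%:R) <= alpha / 60.
Proof.
case/andP: alpha_itv => a0 a1.
rewrite ler_pdivrMr; last by have := n_ge1; lra.
have -> : alpha / 60 * (60 * n%:R) = alpha * n%:R by field.
by have := n_ge1; nra.
Qed.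

Lemma iterate_ge i : alpha / 2 <= x i.
Proof.
have := resolvent_ge i; have := x_close i; have := delta_le.
rewrite ler_norml => h1 /andP[h2 h3] h4.
by case/andP: alpha_itv => a0 a1; lra.
Qed.

Lemma iterate_le i : x i <= 4 * n%:R / alpha.
Proof.
have := resolvent_le i; have := x_close i; have := delta_le.
rewrite ler_norml => h1 /andP[h2 h3] h4.
have a0 := alpha_gt0; case/andP: alpha_itv => _ a1.
have : (\sum_j e j) / alpha <= 3 * n%:R / alpha by rewrite ler_wpM2r // invr_ge0 ltW.
have : 1 <= n%:R / alpha by rewrite ler_pdivlMr //; have := n_ge1; lra.
have -> : 4 * n%:R / alpha = 3 * n%:R / alpha + n%:R / alpha by field; lra.
by lra.
Qed.

(** The factor [(1 + alpha) / 4 < 3 / 8] leaves room up to [1 / 2]; this room and the extra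
    [alpha * n%:R / 4] pay for the distance between [x] and [y]. *)
Lemma sum_excess_iterate_le :
  \sum_i excess x i <= (\sum_i e i) / 2 + 5 / 4 * alpha * n%:R.
Proof.
set d := alpha ^+ 2 / (60 * n%:R).
have a0 := alpha_gt0; case/andP: (alpha_itv) => _ a1.
have n1 := n_ge1.
have d_ge0 : 0 <= d by apply: le_trans (x_close (Ordinal n_gt0)).
have d_le : d <= alpha / 60 by exact: delta_le.
have dn : d * n%:R = alpha ^+ 2 / 60 by rewrite /d; field; lra.
(* The bound [1 - 1/x <= x/4] turns the decrease of the excess into the
   conserved quantity [sum_i e i * y i = sum_i e i]. *)
have ex_le i : excess x i <= alpha + (1 + alpha) *
    (e i * (y i + d) / 4 + 2 * d / alpha * (1 + e i + n%:R)).
  have xi := iterate_ge i; have xi0 : 0 < x i by lra.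
  have ei := e_gt0 i.
  have y_le : y i <= x i + d.
    by have := x_close i; rewrite ler_norml -/d => /andP[] *; lra.
  have x_le : x i <= y i + d.
    by have := x_close i; rewrite ler_norml -/d => /andP[] *; lra.
  have Wx : \sum_j W i j * x j <= \sum_j W i j * y j + n%:R * d.
    have -> : n%:R * d = \sum_(j < n) d by rewrite sumr_const card_ord mulr_natl.
    rewrite -big_split; apply: ler_sum => j _ /=.
    have W1 : W i j <= 1.
      by rewrite -(W_sum1 j) (bigD1 i) //= lerDl sumr_ge0.
    have := x_close j; rewrite ler_norml -/d => /andP[_ h].
    have := W_ge0 i j; nra.
  have Wy : \sum_j W i j * y j = (1 + e i) * y i - e i by have := y_eq i; lra.
  have ratio : (\sum_j W i j * x j) / x i
      <= 1 + e i * (y i + d) / 4 + 2 * d / alpha * (1 + e i + n%:R).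
    rewrite ler_pdivrMr //.
    apply: (le_trans Wx); rewrite Wy.
    have t1 : (1 + e i) * y i <= (1 + e i) * x i + (1 + e i) * d by nra.
    (* The additive error becomes a multiple of [x i] because [2 * x i / alpha >= 1]. *)
    have t2 : (1 + e i + n%:R) * d <= 2 * d / alpha * (1 + e i + n%:R) * x i.
      have -> : 2 * d / alpha * (1 + e i + n%:R) * x i
         = (1 + e i + n%:R) * d * (2 * x i / alpha) by field; lra.
      rewrite ler_peMr //; first by rewrite mulr_ge0 //; lra.
      by rewrite ler_pdivlMr //; lra.
    (* From [(x i - 2) ^+ 2 >= 0] comes [x i - 1 <= x i ^+ 2 / 4]; one factor [x i] is then relaxed
       to [y i + d], which the conserved sum controls. *)
    have t3 : e i * x i - e i <= e i * (y i + d) / 4 * x i.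
      have : 0 <= e i * (x i - 2) ^+ 2 by rewrite mulr_ge0 ?sqr_ge0 ?ltW.
      have : 0 <= e i * x i * (y i + d - x i) by rewrite !mulr_ge0 //; lra.
      by nra.
    lra.
  rewrite /excess ge_max -(mulrA _ _ (x i)^-1); apply/andP; split.
    rewrite lerDl mulr_ge0 //; first by lra.
    apply: addr_ge0.
      by rewrite divr_ge0 // mulr_ge0 ?addr_ge0 ?resolvent_ge0 // ltW.
    by rewrite mulr_ge0 // ?divr_ge0 //; lra.
  have : (1 + alpha) * ((\sum_j W i j * x j) / x i) <= (1 + alpha) *
    (1 + e i * (y i + d) / 4 + 2 * d / alpha * (1 + e i + n%:R)).
    by rewrite ler_wpM2l //; lra.
  lra.
apply: (le_trans (ler_sum _ (fun i _ => ex_le i))).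
set u := \sum_i e i; have u_ge0 : 0 <= u by apply: sumr_ge0 => i _; rewrite ltW.
have -> : \sum_i (alpha + (1 + alpha) *
    (e i * (y i + d) / 4 + 2 * d / alpha * (1 + e i + n%:R)))
  = alpha * n%:R + (1 + alpha) * ((1 + d) / 4 * u
      + 2 * d / alpha * (n%:R + u + n%:R * n%:R)).
  rewrite big_split /= sumr_const card_ord -(mulr_natr alpha); congr (_ + _).
  rewrite -mulr_sumr big_split /=; congr (_ * (_ + _)).
    rewrite -mulr_suml; under eq_bigr => i _ do rewrite mulrDr.
    by rewrite big_split /= resolvent_weighted_sum -mulr_suml -/u; field.
  rewrite -mulr_sumr !big_split /= !sumr_const card_ord -/u.
  by rewrite -[in LHS]mulr_natr -[in X in _ = X]mulr_natl; ring.
(* The bracket is at most [5 * n%:R * n%:R], and [d * n%:R = alpha ^+ 2 / 60] gives the [1 / 6]. *)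
have t1 : 2 * d / alpha * (n%:R + u + n%:R * n%:R) <= alpha * n%:R / 6.
  have -> : alpha * n%:R / 6 = 2 * d / alpha * (5 * n%:R * n%:R).
    have -> : 2 * d / alpha * (5 * n%:R * n%:R) = 10 * (d * n%:R) * n%:R / alpha.
      by field; lra.
    by rewrite dn; field; lra.
  rewrite ler_wpM2l //; first by rewrite divr_ge0 //; lra.
  have := e_le; rewrite -/u; nra.
have t2 : (1 + d) / 4 * u <= (1 + 1 / 120) / 4 * u.
  by rewrite ler_wpM2r //; lra.
have t3 : 0 <= alpha * n%:R by rewrite mulr_ge0 //; lra.
have : (1 + alpha) * ((1 + d) / 4 * u + 2 * d / alpha * (n%:R + u + n%:R * n%:R))
    <= (1 + alpha) * ((1 + 1 / 120) / 4 * u + alpha * n%:R / 6).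
  by rewrite ler_wpM2l ?lerD //; lra.
have : (1 + alpha) * ((1 + 1 / 120) / 4 * u + alpha * n%:R / 6)
    <= 3 / 2 * ((1 + 1 / 120) / 4 * u + alpha * n%:R / 6).
  by rewrite ler_wpM2r //; lra.
lra.
Qed.

(** Above the threshold, [5 / 4 * alpha * n%:R] is less than [5 / 12] of the sum, and
    [1 / 2 + 5 / 12 = 11 / 12]. *)
Lemma sum_excess_iterate_lt : 3 * alpha * n%:R < \sum_i e i ->
  \sum_i excess x i <= 11 / 12 * \sum_i e i.
Proof. by have := sum_excess_iterate_le; lra. Qed.

End Resolvent.

Lemma excess_ge x i : alpha <= excess x i.
Proof. by rewrite le_max lexx. Qed.

Lemma excess_row x i : 0 < x i ->
  (1 + alpha) * (\sum_j W i j * x j) <= (1 + excess x i) * x i.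
Proof.
move=> xi; rewrite -ler_pdivrMr //.
have : (1 + alpha) * (\sum_j W i j * x j) / x i - 1 <= excess x i.
  by rewrite le_max lexx orbT.
lra.
Qed.

(** Bounding the maximum by [alpha + (1 + alpha) * \sum_j W i j] and exchanging the sums gives
    [(1 + 2 * alpha) * n%:R]. *)
Lemma sum_excess_one_le : \sum_i excess (fun=> 1) i <= 3 * n%:R.
Proof.
case/andP: alpha_itv => a0 a1.
apply: (@le_trans _ _ (\sum_i (alpha + (1 + alpha) * \sum_j W i j))).
  apply: ler_sum => i _.
  have : 0 <= (1 + alpha) * \sum_j W i j.
    by rewrite mulr_ge0 ?sumr_ge0 //; lra.
  have -> : \sum_j W i j = \sum_j W i j * (fun=> 1) j.
    by apply: eq_bigr => j _; rewrite /= mulr1.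
  by rewrite /excess divr1 ge_max => h; apply/andP; split; lra.
rewrite big_split /= -mulr_sumr sumr_const card_ord exchange_big /=.
under eq_bigr => j _ do rewrite W_sum1.
rewrite sumr_const card_ord -mulr_natr.
have : 0 <= n%:R :> R by []. nra.
Qed.

End Iteration.

(** * Laplacians, RCDD matrices and coordinate lists *)

Section Diagonal.
Context {R : realType} {n : nat}.

Lemma norm_wrt_diag (d : 'rV[R]_n) (x : 'cV[R]_n) :
  norm_wrt (diag_mx d) x = Num.sqrt (\sum_i d 0 i * x i 0 ^+ 2).
Proof.
rewrite /norm_wrt mul_mx_diag mxE; congr (Num.sqrt _).
by apply: eq_bigr => i _; rewrite !mxE expr2; ring.
Qed.

Lemma invmx_diag (d : 'rV[R]_n) : (forall i, d 0 i != 0) ->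
  invmx (diag_mx d) = diag_mx (\row_i (d 0 i)^-1).
Proof.
move=> d_neq0.
have dd : diag_mx d *m diag_mx (\row_i (d 0 i)^-1) = 1%:M.
  rewrite mulmx_diag; apply/matrixP => i j; rewrite !mxE.
  by have [->|//] := eqVneq i j; rewrite divff.
have [d_unit _] := mulmx1_unit dd.
by rewrite -[RHS]mul1mx -(mulVmx d_unit) -mulmxA dd mulmx1.
Qed.

Lemma kappa_le (S : 'M[R]_n) (lo hi : R) : (0 < n)%N -> 0 < lo ->
  (forall i, lo <= `|S i i| <= hi) -> (kappa S <= (hi / lo)%:E)%E.
Proof.
move=> n_gt0 lo_gt0 S_itv; pose i0 := Ordinal n_gt0.
have hi_ge0 : 0 <= hi by case/andP: (S_itv i0) => _; apply: le_trans.
have max_le : max_diag S <= hi.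
  by apply: bigmax_le => // i _; case/andP: (S_itv i).
have max_ge : lo <= max_diag S.
  by apply: (bigmax_sup i0) => //; case/andP: (S_itv i0).
have min_ge : lo <= min_diag S.
  by apply/bigmin_geP; split => // i _; case/andP: (S_itv i).
rewrite /kappa gt_eqF ?(lt_le_trans lo_gt0) // lee_fin.
by rewrite ler_pM ?invr_ge0 ?lef_pV2 ?posrE ?(le_trans (ltW lo_gt0)) // (lt_le_trans lo_gt0).
Qed.

Lemma unitmx_col_inj (A : 'M[R]_n) :
  (forall z : 'cV_n, A *m z = 0 -> z = 0) -> A \in unitmx.
Proof.
move=> A_inj; rewrite -unitmx_tr -row_free_unit -kermx_eq0.
apply/rowV0P => v; rewrite sub_kermx => /eqP vA.
apply: trmx_inj; rewrite trmx0; apply: A_inj.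
by apply: trmx_inj; rewrite trmx_mul trmxK trmx0.
Qed.

End Diagonal.

Section Laplacian.
Context {R : realType} {n : nat} (L : 'M[R]_n).
Hypothesis L_lap : directed_laplacian L.
Hypothesis L_diag : forall i, 0 < L i i.

(** For a Laplacian with positive diagonal this is the transition matrix, from [j] to [i], of a
    random walk. *)
Definition walk (i j : 'I_n) : R := if i == j then 0 else - L i j / L j j.

(* [(diag e + L D^-1) X] with [D = diag L] and [X = diag x]. *)
Definition scaled (e x : 'I_n -> R) : 'M[R]_n :=
  \matrix_(i, j) (L i j / L j j * ((if i == j then 1 + e j else 1) * x j)).

Lemma walk_ge0 i j : 0 <= walk i j.
Proof.
rewrite /walk; have [//|ij] := eqVneq i j.
by rewrite divr_ge0 ?(ltW (L_diag j)) // oppr_ge0; apply: L_lap.1.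
Qed.

Lemma walk_sum1 j : \sum_i walk i j = 1.
Proof.
have /rowP/(_ j) := L_lap.2; rewrite !mxE (bigD1 j) //= mxE mul1r => Lj.
rewrite (bigD1 j) //= /walk eqxx add0r.
rewrite (eq_bigr (fun i => - L i j / L j j)); last by move=> i /negPf->.
rewrite -mulr_suml sumrN.
suff -> : - (\sum_(i | i != j) L i j) = L j j by rewrite divff // gt_eqF.
apply/eqP; rewrite eq_sym -addr_eq0 -[X in _ == X]Lj; apply/eqP; congr (_ + _).
by apply: eq_bigr => i _; rewrite mxE mul1r.
Qed.

Lemma scaled_diag e x i : scaled e x i i = (1 + e i) * x i.
Proof. by rewrite mxE eqxx divff ?mul1r // gt_eqF. Qed.

Lemma scaled_off e x i j : i != j -> scaled e x i j = - (walk i j * x j).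
Proof. by move=> ij; rewrite mxE /walk (negPf ij); ring. Qed.

Lemma sum_walk (x : 'I_n -> R) i :
  \sum_j walk i j * x j = \sum_(j | j != i) walk i j * x j.
Proof. by rewrite (bigD1 i) //= /walk eqxx mul0r add0r. Qed.

Lemma sum_laplacian (x : 'I_n -> R) i :
  \sum_j L i j / L j j * x j = x i - \sum_j walk i j * x j.
Proof.
rewrite sum_walk (bigD1 i) //= divff ?gt_eqF // mul1r -sumrN.
by congr (_ + _); apply: eq_bigr => j ji; rewrite /walk eq_sym (negPf ji); ring.
Qed.

Lemma scaled_mulmx e x (z : 'cV_n) i : (scaled e x *m z) i 0 =
  (1 + e i) * (x i * z i 0) - \sum_j walk i j * (x j * z j 0).
Proof.
rewrite mxE (bigD1 i) //= scaled_diag sum_walk -sumrN mulrA.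
by congr (_ + _); apply: eq_bigr => j ji; rewrite scaled_off ?mulrN ?mulNr ?mulrA // eq_sym.
Qed.

Lemma zmatrix_scaled e x : (forall i, 0 <= x i) -> zmatrix (scaled e x).
Proof.
by move=> x_ge0 i j ij; rewrite scaled_off // oppr_le0 mulr_ge0 ?walk_ge0.
Qed.

Lemma nnz_scaled_le e x : (nnz (scaled e x) <= nnz L)%N.
Proof.
apply/subset_leq_card/subsetP => p; rewrite !inE; apply: contra => /eqP Lp.
by rewrite mxE Lp !mul0r.
Qed.

(** Only the rows need a hypothesis: the off-diagonal part of column [i] has absolute sum exactly
    [x i], so [alpha <= e i] settles the columns whatever [x] is. *)
Lemma rcdd_scaled (alpha : R) e x : 0 <= alpha -> (forall i, 0 <= x i) ->
  (forall i, alpha <= e i) ->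
  (forall i, (1 + alpha) * (\sum_j walk i j * x j) <= (1 + e i) * x i) ->
  rcdd alpha (scaled e x).
Proof.
move=> a_ge0 x_ge0 e_ge row i; rewrite !scaled_diag; split.
  rewrite (eq_bigr (fun j => walk i j * x j)) -?sum_walk // => j ji.
  by rewrite scaled_off 1?eq_sym // normrN ger0_norm // mulr_ge0 ?walk_ge0.
rewrite (eq_bigr (fun j => walk j i * x i)); last first.
  by move=> j ji; rewrite scaled_off // normrN ger0_norm // mulr_ge0 ?walk_ge0.
rewrite -mulr_suml; have := walk_sum1 i; rewrite (bigD1 i) //= /walk eqxx add0r.
by move=> ->; rewrite mul1r ler_wpM2r // lerD2l.
Qed.

(** If [z] is in the kernel, the triangle inequality makes the vector of the [|x i * z i 0|]
    subinvariant, hence zero. *)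
Lemma scaled_unitmx e x : (forall i, 0 < x i) -> (forall i, 0 < e i) ->
  scaled e x \in unitmx.
Proof.
move=> x_gt0 e_gt0; apply: unitmx_col_inj => z Mz.
have xz0 i : `|x i * z i 0| = 0.
  apply: (@subinvariant_eq0 _ _ walk walk_sum1 e (fun i => `|x i * z i 0|)) => // {}i.
  have : (scaled e x *m z) i 0 = 0 by rewrite Mz mxE.
  rewrite scaled_mulmx => /eqP; rewrite subr_eq0 => /eqP eq_i.
  rewrite -[1 + e i]gtr0_norm ?addr_gt0 // -normrM eq_i.
  apply: le_trans (ler_norm_sum _ _ _) _; apply: ler_sum => j _.
  by rewrite normrM ger0_norm ?walk_ge0.
apply/colP => i; rewrite mxE; apply/eqP; have /eqP := xz0 i.
by rewrite normr_eq0 mulf_eq0 gt_eqF.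
Qed.

(** The matrix to be made RCDD has the same form as the query matrices, with a constant vector in
    place of [e]. *)
Lemma shifted_scaled (c : R) (s : 'cV_n) :
  (c *: diag_part L + L) *m invmx (diag_part L) *m diag_vec s
  = scaled (fun=> c) (fun i => s i 0).
Proof.
rewrite invmx_diag; last by move=> i; rewrite mxE gt_eqF.
rewrite !mul_mx_diag; apply/matrixP => i j; rewrite !mxE.
have [->|ij] := eqVneq i j; last by rewrite mulr0n mulr0 add0r mul1r.
have := L_diag j; rewrite mulr1n => Lj; field; lra.
Qed.

Lemma nnz_laplacian_ge : (n <= nnz L)%N.
Proof.
rewrite -[leqLHS]card_ord -cardsT -(card_imset _ (fun i j : 'I_n => fun
  (H : (i, i) = (j, j)) => congr1 fst H)).
apply/subset_leq_card/subsetP => p /imsetP[i _ ->].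
by rewrite inE gt_eqF.
Qed.

End Laplacian.

Lemma sum_key_unique (R : nmodType) (K : eqType) (s : seq (K * R)) k v :
  uniq [seq e.1 | e <- s] -> (k, v) \in s -> \sum_(e <- s | e.1 == k) e.2 = v.
Proof.
elim: s => [//|[k' v'] s IH] /= /andP[k's s_uniq].
rewrite inE big_cons /= => /orP[/eqP[-> ->]|kvs].
  rewrite eqxx big1_seq ?addr0 // => e /andP[/eqP ek es'].
  by case/negP: k's; rewrite -ek map_f.
have [kk'|_] := eqVneq k' k; last exact: IH.
by case/negP: k's; rewrite kk' -[k]/((k, v).1) map_f.
Qed.

Section CoordinateList.
Context {R : realType} {n : nat} (es : coo R).
Hypothesis es_wf : coo_wf n es.

Lemma size_coo_le : (size es <= nnz (coo_mx n es))%N.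
Proof.
case: es_wf => es_uniq /allP es_lt /allP es_neq0.
rewrite /nnz cardE -(size_map (fun e => e.1) es).
rewrite -(size_map (fun p : 'I_n * 'I_n => (p.1 : nat, p.2 : nat))).
apply: uniq_leq_size => // _ /mapP[[[k l] v] ev ->] /=.
have /andP[/= kn ln] := es_lt _ ev.
apply/mapP; exists (Ordinal kn, Ordinal ln) => //.
rewrite mem_enum inE mxE /=.
have := es_neq0 _ ev; rewrite /= -(sum_key_unique _ _ es (k, l) v) //.
Qed.

Definition row_of k := (nth (0%N, 0%N, 0) es k).1.1.
Definition col_of k := (nth (0%N, 0%N, 0) es k).1.2.
Definition val_of k := (nth (0%N, 0%N, 0 : R) es k).2.

Lemma row_of_lt k : (k < size es)%N -> (row_of k < n)%N.
Proof.
by case: es_wf => _ /allP h _ /(mem_nth (0%N, 0%N, 0)) /h /andP[].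
Qed.

Lemma col_of_lt k : (k < size es)%N -> (col_of k < n)%N.
Proof.
by case: es_wf => _ /allP h _ /(mem_nth (0%N, 0%N, 0)) /h /andP[].
Qed.

Lemma val_of_neq0 k : (k < size es)%N -> val_of k != 0.
Proof. by case: es_wf => _ _ /allP h /(mem_nth (0%N, 0%N, 0)) /h. Qed.

Lemma sum_entry (i j : 'I_n) :
  \sum_(0 <= k < size es | (row_of k == i) && (col_of k == j)) val_of k
  = coo_mx n es i j.
Proof. by rewrite mxE (big_nth (0%N, 0%N, 0)). Qed.

(** Grouping the entries of row [i] by column shows that one pass over the list computes a
    matrix-vector product. *)
Lemma sum_entry_row (g : nat -> R) (i : 'I_n) :
  \sum_(0 <= k < size es | row_of k == i) val_of k * g (col_of k)
  = \sum_(j < n) coo_mx n es i j * g j.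
Proof.
under [RHS]eq_bigr => j _ do rewrite -sum_entry mulr_suml.
rewrite [RHS](exchange_big_dep (fun k => row_of k == i)) /=; last first.
  by move=> j k _ /andP[].
rewrite big_nat_cond [RHS]big_nat_cond; apply: eq_bigr => k /andP[/andP[_ kes] ki].
rewrite (bigD1 (Ordinal (col_of_lt _ kes))) /= ?ki ?eqxx //.
rewrite big1 ?addr0 // => j /andP[/eqP kj /negP[]].
by apply/eqP/val_inj.
Qed.

(** This lets a query keep the positions of the input list: only the values change, by a factor
    depending on the position. *)
Lemma coo_mx_rescale (q : nat -> R) (f : nat -> nat -> R) (i j : 'I_n) :
  (forall k, (k < size es)%N -> q k = val_of k * f (row_of k) (col_of k)) ->
  coo_mx n (mkseq (fun k => (row_of k, col_of k, q k)) (size es)) i j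
  = coo_mx n es i j * f i j.
Proof.
move=> qE; rewrite -sum_entry mulr_suml mxE big_map /=.
rewrite /index_iota subn0 big_seq_cond [RHS]big_seq_cond.
apply: eq_bigr => k /andP[]; rewrite mem_iota add0n => /qE -> /andP[/eqP -> /eqP ->].
by [].
Qed.

Lemma coo_wf_rescale (q : nat -> R) :
  (forall k, (k < size es)%N -> q k != 0) ->
  coo_wf n (mkseq (fun k => (row_of k, col_of k, q k)) (size es)).
Proof.
move=> q_neq0; split.
- case: es_wf => h _ _; rewrite -map_comp; congr (is_true (uniq _)): h.
  rewrite -[in LHS](mkseq_nth (0%N, 0%N, 0) es) -map_comp.
  apply/eq_map => k /=; rewrite /row_of /col_of.
  by case: (nth _ _ _) => -[].
- apply/allP => _ /mapP[k kes ->] /=; move: kes; rewrite mem_iota => /= kes.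
  by rewrite row_of_lt ?col_of_lt.
by apply/allP => _ /mapP[k kes ->] /=; move: kes; rewrite mem_iota => /q_neq0.
Qed.

End CoordinateList.

(** * From the norm guarantee of the solver to entrywise accuracy *)

Section Accuracy.
Context {R : realType} {n : nat} (L : 'M[R]_n) (alpha : R).
Hypothesis L_diag : forall i, 0 < L i i.
Hypothesis n_gt0 : (0 < n)%N.
Hypothesis alpha_itv : 0 < alpha < 1 / 2.
Context (e x : 'I_n -> R).
Hypothesis e_ge : forall i, alpha <= e i.
Hypothesis e_le : \sum_j e j <= 3 * n%:R.
Hypothesis x_ge : forall i, alpha / 2 <= x i.
Hypothesis x_le : forall i, x i <= 4 * n%:R / alpha.

(** The diagonal [d i = (1 + e i) * x i] dominates [x i], so the squared error is at most [x i]
    times the term [d i * (z i 0 - zs i 0) ^+ 2] of the squared norm; the first factor is at most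
    [4 * n%:R / alpha], the second is bounded by the guarantee. *)
Lemma scaled_solution_close (b z zs : 'cV[R]_n) :
  (forall i, b i 0 = e i) ->
  norm_wrt (diag_part (scaled L e x)) (z - zs) <=
    alpha ^+ 4 / (540 * n%:R ^+ 3) / alpha *
    norm_wrt (invmx (diag_part (scaled L e x))) b ->
  forall i, `|x i * z i 0 - x i * zs i 0| <= alpha ^+ 2 / (60 * n%:R).
Proof.
case/andP: alpha_itv => a0 a1; have n1 : 1 <= n%:R :> R by rewrite ler1n.
move=> bE; set d := fun i => (1 + e i) * x i.
have x_gt0 i : 0 < x i by have := x_ge i; lra.
have e_gt0 i : 0 < e i by have := e_ge i; lra.
have d_ge i : x i <= d i by rewrite /d; have := x_gt0 i; have := e_gt0 i; nra.
have d_gt0 i : 0 < d i by have := x_gt0 i; have := d_ge i; lra.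
have a_ge0 := ltW a0.
have d_ge0 i := ltW (d_gt0 i).
have x_ge0 i := ltW (x_gt0 i).
have e_ge0 i := ltW (e_gt0 i).
have MD i : (\row_k scaled L e x k k) 0 i = d i by rewrite mxE scaled_diag.
rewrite /diag_part invmx_diag; last by move=> i; rewrite MD gt_eqF.
rewrite !norm_wrt_diag => close i.
set c := alpha ^+ 4 / (540 * n%:R ^+ 3) / alpha in close.
have c_ge0 : 0 <= c.
  by rewrite /c !divr_ge0 ?mulr_ge0 ?exprn_ge0.
(* Here [d j >= alpha / 2], and [\sum_j e j ^+ 2 <= (\sum_j e j) ^+ 2] for nonnegative [e]. *)
have rhs_le : \sum_j (\row_k ((\row_k scaled L e x k k) 0 k)^-1) 0 j * b j 0 ^+ 2
    <= 2 / alpha * (3 * n%:R) ^+ 2.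
  apply: (@le_trans _ _ (2 / alpha * (\sum_j e j) ^+ 2)); last first.
    rewrite ler_wpM2l ?divr_ge0 // ler_pXn2r ?nnegrE ?mulr_ge0 //.
    by rewrite sumr_ge0.
  rewrite expr2 mulr_suml mulr_sumr; apply: ler_sum => j _.
  rewrite mxE MD bE ler_pM ?invr_ge0 ?sqr_ge0//.
    rewrite -[_ / _]invf_div lef_pV2 ?posrE ?divr_gt0 //.
    exact: le_trans (x_ge j) (d_ge j).
  rewrite expr2 ler_wpM2l // (bigD1 j) //= lerDl sumr_ge0 //.
have term_le : d i * (z i 0 - zs i 0) ^+ 2 <= c ^+ 2 * (2 / alpha * (3 * n%:R) ^+ 2).
  move: rhs_le close; set r := \sum_k _; set s := \sum_k _ => r_le close.
  have s_ge0 : 0 <= s.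
    by apply: sumr_ge0 => k _; rewrite MD mulr_ge0 ?sqr_ge0.
  have r_ge0 : 0 <= r.
    by apply: sumr_ge0 => k _; rewrite mxE MD mulr_ge0 ?invr_ge0 ?sqr_ge0.
  apply: (@le_trans _ _ s).
    rewrite /s (bigD1 i) //= MD !mxE lerDl sumr_ge0 // => k _.
    by rewrite MD mulr_ge0 ?sqr_ge0.
  rewrite -(sqr_sqrtr s_ge0).
  apply: (@le_trans _ _ ((c * Num.sqrt r) ^+ 2)).
    by rewrite ler_pXn2r ?nnegrE ?(mulr_ge0 c_ge0) ?sqrtr_ge0.
  by rewrite exprMn sqr_sqrtr // ler_wpM2l ?sqr_ge0.
rewrite -(@ler_pXn2r _ 2) ?nnegrE ?divr_ge0 ?mulr_ge0 ?exprn_ge0//.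
rewrite real_normK ?num_real // -mulrBr exprMn.
apply: (@le_trans _ _ (4 * n%:R / alpha * (c ^+ 2 * (2 / alpha * (3 * n%:R) ^+ 2)))).
  apply: (@le_trans _ _ (x i * (d i * (z i 0 - zs i 0) ^+ 2))).
    by rewrite expr2 -mulrA ler_wpM2l// ler_wpM2r ?sqr_ge0.
  by rewrite ler_pM ?(mulr_ge0 (d_ge0 i) (sqr_ge0 _)).
(* The constant [540] in the accuracy makes the leftover factor [8 / (9 * n%:R)], which is below
   1. *)
have -> : 4 * n%:R / alpha * (c ^+ 2 * (2 / alpha * (3 * n%:R) ^+ 2))
    = (alpha ^+ 2 / (60 * n%:R)) ^+ 2 * (8 / (9 * n%:R)).
  by rewrite /c; field; apply/andP; split; lra.
by rewrite ler_piMr ?sqr_ge0 // ler_pdivrMr; lra.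
Qed.

End Accuracy.

(** * Total correctness and running time of programs *)

Section ProgramLogic.
Context {R : realType} {n : nat} (solve : procedure R n) (good : query R n -> Prop).

(** A triple for total correctness: a halting execution is asserted to exist. The time [t] is only
    an upper bound, so that costs can be rounded up. *)
Definition runs c s (Q : memory R -> Prop) t : Prop :=
  exists s' t' qs,
    [/\ exec solve c s s' t' qs, (t' <= t)%N, Q s' & List.Forall good qs].

Lemma runs_weaken c s (Q Q' : memory R -> Prop) t t' :
  runs c s Q t -> (forall s', Q s' -> Q' s') -> (t <= t')%N -> runs c s Q' t'.
Proof.
move=> [s' [u [qs [cs ut Qs good_qs]]]] QQ' tt'.
by exists s', u, qs; split=> //; [apply: leq_trans tt' | apply: QQ'].
Qed.

Lemma runs_seq c d s (Q Q' : memory R -> Prop) t u :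
  runs c s Q t -> (forall s', Q s' -> runs d s' Q' u) ->
  runs (Seq c d) s Q' (t + u).
Proof.
move=> [s1 [t1 [qs1 [cs t1t Qs good1]]]] /(_ _ Qs).
move=> [s2 [t2 [qs2 [ds t2u Qs2 good2]]]].
exists s2, (t1 + t2)%N, (qs1 ++ qs2); split=> //; first exact: exec_seq cs ds.
  exact: leq_add.
by apply/List.Forall_app.
Qed.

Lemma runs_iset a e f s t : (icost e + icost f < t)%N ->
  runs (ISet a e f) s
    (eq (Memory (update (ints s) a (ieval s e) (ieval s f)) (rls s))) t.
Proof. by move=> ht; do 3 eexists; split; [constructor | exact: ht | |]. Qed.

Lemma runs_rset a e f s t k v : (icost e + rcost f < t)%N ->
  ieval s e = k -> reval s f = v ->
  runs (RSet a e f) s (eq (Memory (ints s) (update (rls s) a k v))) t.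
Proof.
by move=> ht <- <-; do 3 eexists; split; [constructor | exact: ht | |].
Qed.

Lemma runs_if b c d s Q t u :
  runs (if beval s b then c else d) s Q t -> ((bcost b + t).+1 <= u)%N ->
  runs (If b c d) s Q u.
Proof.
move=> [s' [t' [qs [cs t't Qs good_qs]]]] tu.
exists s', (bcost b + t').+1, qs; split=> //; first exact: exec_if.
by apply: leq_trans tu; rewrite ltnS leq_add2l.
Qed.

(** The index of [I] bounds the number of rounds left. At index 0 the guard must fail, since
    [0 = j.+1] is impossible. *)
Lemma runs_while (I : nat -> memory R -> Prop) b c Q t k s :
  (forall k s, I k s -> beval s b -> exists2 j, k = j.+1 & runs c s (I j) t) ->
  (forall k s, I k s -> ~~ beval s b -> Q s) ->
  I k s -> runs (While b c) s Q ((bcost b).+1 + k * (bcost b + t).+1).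
Proof.
move=> loop stop; elim: k s => [|k IH] s Is; have [bs|bs] := boolP (beval s b).
- by have [] := loop _ _ Is bs.
- exists s, (bcost b).+1, [::]; split=> //; [exact: exec_while_stop | | exact: stop Is bs].
  by rewrite mul0n addn0.
- have [_ [<-] [s1 [t1 [qs1 [cs t1t Is1 good1]]]]] := loop _ _ Is bs.
  have [s2 [t2 [qs2 [ws t2u Qs2 good2]]]] := IH _ Is1.
  exists s2, (bcost b + t1 + t2).+1, (qs1 ++ qs2); split=> //.
  + exact: exec_while_loop ws.
  + by rewrite mulSn; lia.
  + by apply/List.Forall_app.
- exists s, (bcost b).+1, [::]; split=> //; [exact: exec_while_stop | | exact: stop Is bs].
  exact: leq_addr.
Qed.

Lemma runs_call s t : good (read_query n s) -> ((solve (read_query n s)).2 < t)%N ->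
  runs Call s (eq (write_vec s ra_answer (solve (read_query n s)).1)) t.
Proof.
move=> good_q ht; do 3 eexists; split; [exact: exec_call | exact: ht | by [] |].
by constructor.
Qed.

Definition ia_counter := 6%N.
Definition counter : iexp := IGet ia_counter (IConst 0).

(* [b = 0] runs over the coordinates, [b = 1] over the entries of the matrix. *)
Definition loop (b : nat) (body : cmd) : cmd :=
  Seq (ISet ia_counter (IConst 0) (IConst 0))
      (While (BILt counter (IGet ia_size (IConst b)))
         (Seq body (ISet ia_counter (IConst 0) (IAdd counter (IConst 1))))).

Definition set_counter (s : memory R) k :=
  Memory (update (ints s) ia_counter 0%N k) (rls s).

(** The invariant is demanded of the memory whose counter has already advanced, so it need not be
    shown separately to survive the increment. *)
Lemma runs_loop (J : nat -> memory R -> Prop) N b body t s :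
  (forall k s', J k s' -> ints s' ia_size b = N) ->
  (forall k s', (k < N)%N -> J k s' -> ints s' ia_counter 0%N = k ->
    runs body s' (fun s'' => ints s'' ia_counter 0%N = k /\
                             J k.+1 (set_counter s'' k.+1)) t) ->
  J 0%N (set_counter s 0) ->
  runs (loop b body) s (J N) (N.+1 * (t + 12)).
Proof.
move=> J_bound step J0.
pose I j s' := exists k, [/\ (k + j)%N = N, ints s' ia_counter 0%N = k & J k s'].
(* Resetting the counter costs 3 and the final failing test 6; a round costs the body, 6 for the
   increment and 6 for the test. *)
apply: (@runs_weaken _ _ (J N) _ (3 + (6 + N * (5 + (t + 6)).+1)));
  [|by [] | by rewrite mulSn; lia].
apply: runs_seq; first by apply: (runs_iset _ _ _ _ 3).
move=> _ <- /=; apply: (@runs_while I).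
- move=> j s' [k [kj ck Jk]] /=; rewrite ck (J_bound _ _ Jk) => kN.
  case: j kj => [|j] kj; first by rewrite addn0 in kj; rewrite kj ltnn in kN.
  exists j => //; apply: runs_seq; first exact: step kN Jk ck.
  move=> s'' [ck' Jk']; apply: runs_weaken; first by apply: (runs_iset _ _ _ _ 6).
    move=> _ <- /=; exists k.+1; split; first by rewrite addSnnS.
      by rewrite /update /= ck' addn1.
    by rewrite ck' addn1.
  by [].
- move=> j s' [k [kj ck Jk]] /=; rewrite ck (J_bound _ _ Jk) -leqNgt => Nk.
  by have -> : N = k by lia.
- exists 0%N; split; [exact: add0n | by [] | exact: J0].
Qed.

(** Frame condition for code that writes one real array; the counter is exempt because every loop
    overwrites it. *)
Definition agree_off (a : nat) (s s' : memory R) :=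
  (forall b k, b != ia_counter -> ints s' b k = ints s b k) /\
  (forall b k, b != a -> rls s' b k = rls s b k).

(** The invariant also records that cells from [k] on are still untouched, so the body may update
    [a] in place from its old value. *)
Lemma runs_loop_map a b body (F : nat -> R) s N t :
  ints s ia_size b = N ->
  (forall k s', (k < N)%N -> agree_off a s s' -> rls s' a k = rls s a k ->
    ints s' ia_counter 0%N = k ->
    runs body s' (eq (Memory (ints s') (update (rls s') a k (F k)))) t) ->
  runs (loop b body) s
    (fun s' => agree_off a s s' /\ forall k, (k < N)%N -> rls s' a k = F k)
    (N.+1 * (t + 12)).
Proof.
move=> sN step.
pose J k s' := agree_off a s s' /\
  forall j, rls s' a j = if (j < k)%N then F j else rls s a j.
apply: (@runs_weaken _ _ (J N) _ (N.+1 * (t + 12)));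
  first apply: (@runs_loop J _ _ _ t) => [k s' [[hi hr] _]|k s' kN|].
- by rewrite hi.
- move=> [ag hJ] ck; apply: (runs_weaken _ _ _ _ t).
  + by apply: (step k s') => //; rewrite hJ ltnn.
  + move=> _ <- /=; split=> //; split.
      split=> [c j c6|c j ca] /=; last by rewrite /update (negPf ca) /= ag.2.
      by rewrite /update (negPf c6) /= ag.1.
    move=> j; rewrite /= /update eqxx /= hJ ltnS (leq_eqVlt j).
    by have [->|] := eqVneq j k.
  + exact: leqnn.
- by split=> //; split=> // c j c6; rewrite /= /update (negPf c6).
- by move=> s' [ag hJ]; split=> // k kN; rewrite hJ kN.
- exact: leqnn.
Qed.

(** Covers scattered accumulation, as in a sparse matrix-vector product, and scalar sums, for which
    [idx] is constantly 0. *)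
Lemma runs_loop_add a b body (idx : nat -> nat) (G : nat -> R) s N t :
  ints s ia_size b = N ->
  (forall k s', (k < N)%N -> agree_off a s s' -> ints s' ia_counter 0%N = k ->
    runs body s' (eq (Memory (ints s')
      (update (rls s') a (idx k) (rls s' a (idx k) + G k)))) t) ->
  runs (loop b body) s
    (fun s' => agree_off a s s' /\
       forall j, rls s' a j = rls s a j + \sum_(0 <= k < N | idx k == j) G k)
    (N.+1 * (t + 12)).
Proof.
move=> sN step.
pose J k s' := agree_off a s s' /\
  forall j, rls s' a j = rls s a j + \sum_(0 <= i < k | idx i == j) G i.
apply: (@runs_loop J) => [k s' [[hi hr] _]|k s' kN|].
- by rewrite hi.
- move=> [ag hJ] ck; apply: (runs_weaken _ _ _ _ t).
  + exact: (step k s').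
  + move=> _ <- /=; split=> //; split.
      split=> [c j c6|c j ca] /=; last by rewrite /update (negPf ca) /= ag.2.
      by rewrite /update (negPf c6) /= ag.1.
    move=> j; rewrite /= /update eqxx /= !hJ.
    rewrite [in RHS]big_mkcond big_nat_recr //= -big_mkcond /= eq_sym.
    have [<-|_] := eqVneq (idx k) j. by rewrite addrA.
    by rewrite addr0.
  + exact: leqnn.
- split; first by split=> // c j c6; rewrite /= /update (negPf c6).
  by move=> j; rewrite big_nil addr0.
Qed.

End ProgramLogic.

(** * The algorithm *)

Definition ra_diag := 7%N.
Definition ra_lap := 8%N.
Definition ra_dim := 9%N.
Definition ra_excess := 10%N.
Definition ra_total := 11%N.

Definition icell a : iexp := IGet a counter.
Definition rcell a : rexp := RGet a counter.
Definition rscalar a : rexp := RGet a (IConst 0).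

(** All queries share the positions of the input entries, so these are written once, before the
    rounds start. *)
Definition copy_pattern : cmd :=
  loop 1 (Seq (ISet ia_qrow counter (icell ia_row))
              (ISet ia_qcol counter (icell ia_col))).

Definition on_diagonal : bexp :=
  BAnd (BNot (BILt (icell ia_row) (icell ia_col)))
       (BNot (BILt (icell ia_col) (icell ia_row))).

(** Off the diagonal 0 is added instead of skipping, which gives both branches the form required by
    [runs_loop_add]. *)
Definition extract_diagonal : cmd :=
  loop 1 (If on_diagonal
    (RSet ra_diag (icell ia_col) (RAdd (RGet ra_diag (icell ia_col)) (rcell ra_val)))
    (RSet ra_diag (icell ia_col) (RAdd (RGet ra_diag (icell ia_col)) (RConst 0)))).

(** Indices cannot be converted to reals, so [n] is obtained as a real by counting. *)
Definition compute_dim : cmd :=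
  loop 0 (RSet ra_dim (IConst 0) (RAdd (rscalar ra_dim) (RConst 1))).

Definition square (f : rexp) : rexp := RMul f f.

Definition set_accuracy : cmd :=
  RSet ra_qeps (IConst 0)
    (RDiv (square (square (rscalar ra_alpha)))
          (RMul (RConst 540) (RMul (rscalar ra_dim) (square (rscalar ra_dim))))).

(** [ra_lap] holds [L D^-1 x = x - W x], so the difference with [x] is [W x]. *)
Definition candidate_excess : rexp :=
  RSub (RDiv (RMul (RAdd (RConst 1) (rscalar ra_alpha))
                   (RSub (rcell ra_out) (rcell ra_lap)))
             (rcell ra_out))
       (RConst 1).

Definition compute_excess : cmd :=
  Seq (loop 0 (RSet ra_lap counter (RConst 0)))
  (Seq (loop 1 (RSet ra_lap (icell ia_row) (RAdd (RGet ra_lap (icell ia_row))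
         (RMul (RDiv (rcell ra_val) (RGet ra_diag (icell ia_col)))
               (RGet ra_out (icell ia_col))))))
  (Seq (loop 0 (If (BRLt candidate_excess (rscalar ra_alpha))
                   (RSet ra_qrhs counter (rscalar ra_alpha))
                   (RSet ra_qrhs counter candidate_excess)))
  (Seq (RSet ra_excess (IConst 0) (RConst 0))
       (loop 0 (RSet ra_excess (IConst 0)
                  (RAdd (rscalar ra_excess) (rcell ra_qrhs))))))).

Definition build_query : cmd :=
  loop 1 (If on_diagonal
    (RSet ra_qval counter
       (RMul (RDiv (rcell ra_val) (RGet ra_diag (icell ia_col)))
          (RMul (RAdd (RConst 1) (RGet ra_qrhs (icell ia_col)))
                (RGet ra_out (icell ia_col)))))
    (RSet ra_qval counter
       (RMul (RDiv (rcell ra_val) (RGet ra_diag (icell ia_col)))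
             (RGet ra_out (icell ia_col))))).

(** The query matrix has its columns scaled by [x], so its answer [z] stands for the iterate with
    entries [x i * z i]. The right-hand side is the excess left in [ra_qrhs] by the previous
    [compute_excess]. *)
Definition iteration : cmd :=
  Seq build_query
  (Seq Call
  (Seq (loop 0 (RSet ra_out counter (RMul (rcell ra_out) (rcell ra_answer))))
       compute_excess)).

Definition excess_large : bexp :=
  BRLt (RMul (RMul (RConst 3) (rscalar ra_alpha)) (rscalar ra_dim))
       (rscalar ra_excess).

Definition normalize : cmd :=
  Seq (RSet ra_total (IConst 0) (RConst 0))
  (Seq (loop 0 (RSet ra_total (IConst 0) (RAdd (rscalar ra_total) (rcell ra_out))))
       (loop 0 (RSet ra_out counter (RDiv (rcell ra_out) (rscalar ra_total))))).

Definition prepare : cmd :=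
  Seq copy_pattern
  (Seq (ISet ia_qsize (IConst 0) (IGet ia_size (IConst 1)))
  (Seq extract_diagonal
  (Seq compute_dim
  (Seq set_accuracy
  (Seq (loop 0 (RSet ra_out counter (RConst 1)))
       compute_excess))))).

Definition scaling_program : cmd :=
  Seq prepare (Seq (While excess_large iteration) normalize).

(** * Correctness of the program, its queries and its running time *)

Section Correctness.
Context {R : realType} {n : nat} (alpha : R) (L : 'M[R]_n) (es : coo R).
Context (solve : procedure R n) (T : nat).
Hypothesis n_gt0 : (0 < n)%N.
Hypothesis alpha_itv : 0 < alpha < 1 / 2.
Hypothesis L_lap : directed_laplacian L.
Hypothesis L_diag : forall i, 0 < L i i.
Hypothesis es_wf : coo_wf n es.
Hypothesis es_L : coo_mx n es = L.

Let B := 540%:R * (n%:R / alpha) ^+ 4.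
Hypothesis solve_spec : rcdd_solver alpha (1 * nnz L) B T solve.

Let good (q : query R n) : Prop :=
  admissible alpha (1 * nnz L) B q /\
  (kappa (diag_part (q_mx q)) <= (32%:R * (n%:R / alpha) ^+ 2)%:E)%E.

Let W := walk L.
Let W_ge0 := walk_ge0 L L_lap L_diag.
Let W_sum1 := walk_sum1 L L_lap L_diag.
(* Running time of a loop whose body takes time at most 100. *)
Let K := ((size es).+1 * 112)%N.

(** The [n] diagonal entries are nonzero, hence listed. Loops over coordinates are thus no longer
    than loops over entries, and [K] bounds both. *)
Let n_le : (n <= size es)%N.
Proof.
have [es_uniq _ _] := es_wf.
apply: leq_trans (_ : nnz L <= _)%N; first exact: nnz_laplacian_ge.
rewrite -es_L /nnz cardE -(size_map (fun p : 'I_n * 'I_n => (p.1 : nat, p.2 : nat))).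
rewrite -(size_map (fun e => e.1) es).
apply: uniq_leq_size.
  rewrite map_inj_uniq ?enum_uniq // => -[i j] [k l] [ik jl].
  by congr (_, _); apply: val_inj.
move=> _ /mapP[[i j] + ->]; rewrite mem_enum inE mxE /= => es_ij.
have /hasP[e e_in /andP[/eqP <- /eqP <-]] :
    has (fun e => (e.1.1 == i :> nat) && (e.1.2 == j :> nat)) es.
  apply: contraNT es_ij => /hasPn none; rewrite big1_seq // => e /andP[eij /none].
  by rewrite eij.
by rewrite -surjective_pairing map_f.
Qed.

Let row := row_of es.
Let col := col_of es.
Let val := val_of es.

Definition loaded (s : memory R) : Prop :=
  [/\ ints s ia_size 0%N = n, ints s ia_size 1%N = size es,
      forall k, (k < size es)%N -> ints s ia_row k = row k /\ ints s ia_col k = col k,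
      rls s ra_alpha 0%N = alpha
    & forall k, (k < size es)%N -> rls s ra_val k = val k].

Definition patterned (s : memory R) : Prop :=
  ints s ia_qsize 0%N = size es /\
  forall k, (k < size es)%N -> ints s ia_qrow k = row k /\ ints s ia_qcol k = col k.

Definition prepared (s : memory R) : Prop :=
  [/\ loaded s, patterned s, forall i : 'I_n, rls s ra_diag i = L i i,
      rls s ra_dim 0%N = n%:R
    & rls s ra_qeps 0%N = alpha ^+ 4 / (540 * n%:R ^+ 3)].

Definition cells (s : memory R) a : 'I_n -> R := fun i => rls s a i.

Lemma loaded_agree a s s' : a \notin [:: ra_alpha; ra_val] ->
  agree_off a s s' -> loaded s -> loaded s'.
Proof.
rewrite !inE !negb_or => /andP[a0 a1] [hi hr] [h0 h1 h2 h3 h4].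
split; rewrite ?hi ?hr 1?eq_sym //.
  by move=> k /h2 [<- <-]; rewrite !hi.
by move=> k /h4 <-; rewrite hr // eq_sym.
Qed.

Lemma patterned_agree a s s' : agree_off a s s' -> patterned s -> patterned s'.
Proof.
move=> [hi _] [h0 h1]; split; rewrite ?hi //.
by move=> k /h1 [<- <-]; rewrite !hi.
Qed.

Lemma prepared_agree a s s' :
  a \notin [:: ra_alpha; ra_val; ra_diag; ra_dim; ra_qeps] ->
  agree_off a s s' -> prepared s -> prepared s'.
Proof.
rewrite !inE !negb_or => /and5P[a0 a1 a2 a3 a4] ag [h0 h1 h2 h3 h4].
split.
- by apply: loaded_agree ag h0; rewrite !inE negb_or a0 a1.
- exact: patterned_agree ag h1.
- by move=> i; rewrite ag.2 // eq_sym.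
- by rewrite ag.2 // eq_sym.
- by rewrite ag.2 // eq_sym.
Qed.

Lemma runs_map a b N body (F : nat -> R) s : (N <= size es)%N ->
  ints s ia_size b = N ->
  (forall k s', (k < N)%N -> agree_off a s s' -> rls s' a k = rls s a k ->
    ints s' ia_counter 0%N = k ->
    runs solve good body s' (eq (Memory (ints s') (update (rls s') a k (F k)))) 100) ->
  runs solve good (loop b body) s
    (fun s' => agree_off a s s' /\ forall k, (k < N)%N -> rls s' a k = F k) K.
Proof.
move=> N_le sN step; apply: runs_weaken; first exact: runs_loop_map step.
  by [].
by rewrite leq_mul2r ltnS N_le orbT.
Qed.

Lemma runs_add a b N body (idx : nat -> nat) (G : nat -> R) s :
  (N <= size es)%N -> ints s ia_size b = N ->
  (forall k s', (k < N)%N -> agree_off a s s' -> ints s' ia_counter 0%N = k ->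
    runs solve good body s' (eq (Memory (ints s')
      (update (rls s') a (idx k) (rls s' a (idx k) + G k)))) 100) ->
  runs solve good (loop b body) s
    (fun s' => agree_off a s s' /\
       forall j, rls s' a j = rls s a j + \sum_(0 <= k < N | idx k == j) G k) K.
Proof.
move=> N_le sN step; apply: runs_weaken; first exact: runs_loop_add step.
  by [].
by rewrite leq_mul2r ltnS N_le orbT.
Qed.

Lemma runs_compute_excess s : prepared s -> (forall i, 0 < cells s ra_out i) ->
  runs solve good compute_excess s
    (fun s' => [/\ prepared s', cells s' ra_out =1 cells s ra_out,
      cells s' ra_qrhs =1 excess alpha W (cells s ra_out)
    & rls s' ra_excess 0%N = \sum_i excess alpha W (cells s ra_out) i]) (5 * K).
Proof.
move=> s_prep x_gt0; have -> : (5 * K = K + (K + (K + (K + K))))%N by lia.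
apply: runs_seq.
  apply: (@runs_map ra_lap _ n _ (fun=> 0)) => //; first by case: s_prep => -[].
  by move=> k s' kn ag _ ck; apply: runs_rset.
move=> s1 [ag1 lap1].
have s1_prep : prepared s1 by apply: prepared_agree ag1 s_prep.
apply: runs_seq.
  apply: (@runs_add ra_lap _ (size es) _ row
    (fun k => val k * ((rls s ra_diag (col k))^-1 * rls s ra_out (col k)))) => //.
    by case: s1_prep => -[].
  move=> k s' kes ag ck; apply: runs_rset => //.
    case: s1_prep => -[_ _ /(_ _ kes)[rk _] _ _ _ _ _ _].
    by rewrite /= ck ag.1.
  case: s1_prep => -[_ _ /(_ _ kes)[rk colk] _ /(_ _ kes) valk _ _ _ _].
  rewrite /= ck !ag.1 // rk colk (ag.2 ra_val) // valk.
  by rewrite (ag.2 ra_diag) // (ag.2 ra_out) // (ag1.2 ra_diag) // (ag1.2 ra_out) // mulrA.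
move=> s2 [ag2 lap2].
have s2_prep : prepared s2 by apply: prepared_agree ag2 s1_prep.
have x2 : cells s2 ra_out =1 cells s ra_out.
  by move=> i; rewrite /cells ag2.2 // ag1.2.
have lapE (i : 'I_n) :
    rls s2 ra_lap i = cells s ra_out i - \sum_j W i j * cells s ra_out j.
  rewrite lap2 lap1 // add0r.
  rewrite (sum_entry_row es es_wf
    (fun j => (rls s ra_diag j)^-1 * rls s ra_out j)) es_L.
  rewrite -sum_laplacian //; apply: eq_bigr => j _.
  by case: s_prep => _ _ -> _ _; rewrite mulrA.
pose F k := if insub k is Some i then excess alpha W (cells s ra_out) i else 0.
have FE (i : 'I_n) : F i = excess alpha W (cells s ra_out) i by rewrite /F valK.
apply: runs_seq.
  apply: (@runs_map ra_qrhs _ n _ F) => //; first by case: s2_prep => -[].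
  move=> k s' kn ag _ ck; set i := Ordinal kn.
  have al : rls s' ra_alpha 0%N = alpha by case: s2_prep => -[_ _ _ <-]; rewrite ag.2.
  have cand : reval s' candidate_excess
      = (1 + alpha) * (\sum_j W i j * cells s ra_out j) / cells s ra_out i - 1.
    rewrite /= ck al !ag.2 // -[k]/(i : nat) lapE -[rls s2 ra_out i]/(cells s2 ra_out i).
    by rewrite x2 subKr.
  apply: (@runs_if _ _ _ _ _ _ _ _ _ 60) => //.
  have -> : F k = Num.max alpha (reval s' candidate_excess).
    by rewrite cand -[k]/(i : nat) FE.
  have -> : beval s' (BRLt candidate_excess (rscalar ra_alpha))
      = (reval s' candidate_excess < alpha) by rewrite -al.
  by case: ltP => _; apply: runs_rset.
move=> s3 [ag3 e3].
have s3_prep : prepared s3 by apply: prepared_agree ag3 s2_prep.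
apply: runs_seq.
  apply: (runs_weaken _ _ _ _ _ _ 100); first exact: runs_rset.
    by move=> s' <-; exact: erefl.
  by rewrite /K; lia.
move=> s4 s4E.
have ag4 : agree_off ra_excess s3 s4.
  by rewrite -s4E; split=> // b k /= hb; rewrite /update (negPf hb).
have s4_prep : prepared s4 by apply: prepared_agree ag4 s3_prep.
apply: runs_weaken.
- apply: (@runs_add ra_excess _ n _ (fun=> 0%N) F) => //; first by case: s4_prep => -[].
  move=> k s' kn ag ck; apply: runs_rset => //=.
  by rewrite ck (ag.2 ra_qrhs) // ag4.2 // e3.
- move=> s5 [ag5 sum5]; split.
  + by apply: prepared_agree ag5 s4_prep.
  + by move=> i; rewrite /cells ag5.2 // ag4.2 // ag3.2 // [LHS]x2.
  + by move=> i; rewrite /cells ag5.2 // ag4.2 // e3.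
  + rewrite sum5 -s4E /update /= add0r big_mkord.
    by apply: eq_bigr.
- by [].
Qed.

Lemma eq_excess x y : x =1 y -> excess alpha W x =1 excess alpha W y.
Proof.
by move=> xy i; rewrite /excess xy; under eq_bigr => j _ do rewrite xy.
Qed.

Lemma on_diagonalE s k : (k < size es)%N -> loaded s -> ints s ia_counter 0%N = k ->
  beval s on_diagonal = (row k == col k).
Proof.
move=> kes [_ _ /(_ _ kes)[rk ck] _ _] cnt.
by rewrite /= cnt rk ck -!leqNgt -eqn_leq eq_sym.
Qed.

Definition query_factor (s : memory R) (i j : nat) : R :=
  (rls s ra_diag j)^-1 *
  ((if i == j then 1 + rls s ra_qrhs j else 1) * rls s ra_out j).

Lemma runs_build_query s : prepared s ->
  runs solve good build_query s
    (fun s' => agree_off ra_qval s s' /\ forall k, (k < size es)%N ->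
       rls s' ra_qval k = val k * query_factor s (row k) (col k)) K.
Proof.
move=> s_prep; apply: runs_map => //; first by case: s_prep => -[].
move=> k s' kes ag _ ck.
have s'_prep : prepared s' by apply: prepared_agree ag s_prep.
have [s'_load _ _ _ _] := s'_prep.
apply: (@runs_if _ _ _ _ _ _ _ _ _ 60) => //; rewrite (on_diagonalE s' k) //.
have [_ _ /(_ _ kes)[rk colk] _ /(_ _ kes) valk] := s'_load.
rewrite /query_factor; case: ifP => rc; apply: runs_rset => //=.
  by rewrite ck colk valk (ag.2 ra_diag) // (ag.2 ra_qrhs) // (ag.2 ra_out) // !mulrA.
by rewrite ck colk valk (ag.2 ra_diag) // (ag.2 ra_out) // mul1r mulrA.
Qed.

(** Invariant of the main loop. The interval for [x] is the one of [iterate_ge] and [iterate_le],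
    and it contains the starting value 1; the bound [3 * n%:R] controls the next resolvent and the
    diagonal of the query. *)
Definition valid (s : memory R) : Prop :=
  [/\ prepared s,
      forall i, alpha / 2 <= cells s ra_out i <= 4 * n%:R / alpha,
      cells s ra_qrhs =1 excess alpha W (cells s ra_out),
      rls s ra_excess 0%N = \sum_i excess alpha W (cells s ra_out) i
    & \sum_i excess alpha W (cells s ra_out) i <= 3 * n%:R].

Let alpha_gt0 : 0 < alpha. Proof. by case/andP: alpha_itv. Qed.
Let n_ge1 : 1 <= n%:R :> R. Proof. by rewrite ler1n. Qed.

Lemma valid_query s s' : valid s -> agree_off ra_qval s s' ->
  (forall k, (k < size es)%N ->
     rls s' ra_qval k = val k * query_factor s (row k) (col k)) ->
  q_mx (read_query n s') = scaled L (excess alpha W (cells s ra_out)) (cells s ra_out)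
  /\ good (read_query n s').
Proof.
move=> [s_prep x_itv eE _ e_le] ag qval.
set e := excess alpha W (cells s ra_out); set x := cells s ra_out.
have [_ [qsize qpat] _ _ qeps] : prepared s' by apply: prepared_agree ag s_prep.
have cooE : q_coo (read_query n s')
    = mkseq (fun k => (row k, col k, rls s' ra_qval k)) (size es).
  rewrite /= qsize; apply/eq_in_map => k; rewrite mem_iota => /= /qpat[-> ->].
  by [].
have e_ge i : alpha <= e i by exact: excess_ge.
have e_gt0 i : 0 < e i by exact: lt_le_trans (e_ge i).
have x_gt0 i : 0 < x i 
  by case/andP: (x_itv i) => h _; apply: lt_le_trans h; rewrite divr_gt0.
have x_ge0 i : 0 <= x i by exact: ltW.
have qmxE : q_mx (read_query n s') = scaled L e x.
  rewrite /q_mx cooE; apply/matrixP => i j.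
  rewrite (coo_mx_rescale es _ (query_factor s)) //.
  rewrite es_L mxE /query_factor; case: s_prep => _ _ -> _ _.
  rewrite -[rls s ra_qrhs j]/(cells s ra_qrhs j) eE -mulrA.
  by rewrite -[(i : nat) == j]/(i == j).
split=> //; split.
  split.
  - rewrite cooE; apply: coo_wf_rescale => // k kes.
    rewrite qval // /query_factor.
    have -> : col k = Ordinal (col_of_lt es es_wf _ kes) by [].
    set j := Ordinal _.
    case: s_prep => _ _ -> _ _.
    rewrite -[rls s ra_qrhs j]/(cells s ra_qrhs j) eE -[rls s ra_out j]/(x j).
    rewrite !mulf_eq0 invr_eq0 !negb_or (val_of_neq0 es es_wf) //=.
    rewrite (gt_eqF (x_gt0 j)) (gt_eqF (L_diag j)) andbT.
    by case: ifP => _; rewrite ?oner_eq0 // gt_eqF // -/e; have := e_gt0 j; lra.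
  - rewrite qmxE; split; last exact: zmatrix_scaled.
    by apply: rcdd_scaled => // [|i]; [apply: ltW | apply: excess_row].
  - by rewrite qmxE scaled_unitmx.
  - by rewrite qmxE mul1n nnz_scaled_le.
  - rewrite [q_eps _]qeps; split; first by rewrite divr_gt0 ?mulr_gt0 ?exprn_gt0 ?ltr0n.
    have n1 := n_ge1; have a0 := alpha_gt0.
    (* The inverse accuracy has [n%:R ^+ 3]; one more factor [n%:R >= 1] gives a power of
       [n%:R / alpha]. *)
    have -> : (alpha ^+ 4 / (540 * n%:R ^+ 3))^-1 = 540 * (n%:R ^+ 3 / alpha ^+ 4).
      by field; apply/andP; split; lra.
    rewrite /B exprMn exprVn ler_wpM2l // ler_wpM2r ?invr_ge0 ?exprn_ge0 ?(ltW alpha_gt0) //.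
    by rewrite [leRHS]exprS ler_peMl // exprn_ge0.
rewrite qmxE; have n1 := n_ge1; have a0 := alpha_gt0.
(* Diagonal entries [(1 + e i) * x i] are at least [alpha / 2], and at most [4 * n%:R] times
   [4 * n%:R / alpha] since [e i <= 3 * n%:R]. *)
have -> : 32 * (n%:R / alpha) ^+ 2 = (4 * n%:R) * (4 * n%:R / alpha) / (alpha / 2).
  by field; lra.
apply: kappa_le => // [|i]; first by rewrite divr_gt0.
rewrite /diag_part 2!mxE eqxx mulr1n scaled_diag //.
have /andP[x_lo x_hi] := x_itv i.
have e_hi : e i <= 3 * n%:R.
  apply: le_trans e_le; rewrite (bigD1 i) //= lerDl sumr_ge0 // => j _.
  exact: ltW.
rewrite ger0_norm; last by rewrite mulr_ge0 //; have := e_gt0 i; lra.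
apply/andP; split.
  by apply: le_trans x_lo _; rewrite ler_peMl //; have := e_gt0 i; lra.
by rewrite ler_pM //; have := e_gt0 i; lra.
Qed.

Lemma runs_iteration s : valid s -> 3 * alpha * n%:R < rls s ra_excess 0%N ->
  runs solve good iteration s
    (fun s' => valid s' /\ rls s' ra_excess 0%N <= 11 / 12 * rls s ra_excess 0%N)
    (K + (T.+1 + (K + 5 * K))).
Proof.
move=> s_valid; have [s_prep x_itv eE uE e_le] := s_valid => u_gt.
set x := cells s ra_out in x_itv eE uE e_le; set e := excess alpha W x in eE uE e_le.
apply: runs_seq; first exact: runs_build_query.
move=> s1 [ag1 qval1]; have [qmx good_q] := valid_query _ _ s_valid ag1 qval1.
have [close time_le] := solve_spec _ good_q.1.
have s1_prep : prepared s1 by apply: prepared_agree ag1 s_prep.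
set z := (solve (read_query n s1)).1 in close.
set b := q_rhs (read_query n s1) in close.
have bE i : b i 0 = e i by rewrite -eE mxE ag1.2.
rewrite qmx [q_eps _](_ : _ = alpha ^+ 4 / (540 * n%:R ^+ 3)) in close; last first.
  by case: s1_prep.
apply: runs_seq; first exact: runs_call.
move=> s2 s2E.
have ag2 : agree_off ra_answer s1 s2.
  by rewrite -s2E; split=> // c k /= /negPf ->.
have s2_prep : prepared s2 by apply: prepared_agree ag2 s1_prep.
have zE i : cells s2 ra_answer i = z i 0 by rewrite -s2E /cells /= valK.
have xE i : cells s2 ra_out i = x i by rewrite /cells ag2.2 // ag1.2.
apply: runs_seq.
  apply: (@runs_map ra_out _ n _ (fun k => rls s2 ra_out k * rls s2 ra_answer k)) => //.
    by case: s2_prep => -[].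
  move=> k s' kn ag outk ck; apply: runs_rset => //=.
  by rewrite ck outk (ag.2 ra_answer).
move=> s3 [ag3 out3].
have s3_prep : prepared s3 by apply: prepared_agree ag3 s2_prep.
have x3 i : cells s3 ra_out i = x i * z i 0.
  by rewrite -xE -zE -[LHS]/(rls s3 ra_out i) out3.
have e_ge i : alpha <= e i by exact: excess_ge.
have e_gt0 i : 0 < e i by exact: lt_le_trans (e_ge i).
have x_gt0 i : 0 < x i 
  by case/andP: (x_itv i) => h _; apply: lt_le_trans h; rewrite divr_gt0.
(* [y] is the iterate an exact solver would produce; it satisfies the resolvent equation. *)
pose y i := x i * (invmx (scaled L e x) *m b) i 0.
have y_eq i : (1 + e i) * y i - \sum_j W i j * y j = e i.
  rewrite -scaled_mulmx // mulmxA mulmxV ?mul1mx //.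
  exact: scaled_unitmx.
have x_close i : `|cells s3 ra_out i - y i| <= alpha ^+ 2 / (60 * n%:R).
  rewrite x3; apply: (scaled_solution_close L alpha _ _ _ e) close i => // i.
    by case/andP: (x_itv i).
  by case/andP: (x_itv i).
have x3_itv i : alpha / 2 <= cells s3 ra_out i <= 4 * n%:R / alpha.
  apply/andP; split; first exact: (iterate_ge alpha W _ _ _ e y).
  exact: (iterate_le alpha W _ _ _ e y).
apply: runs_weaken; [apply: runs_compute_excess => // i | | by []].
  by case/andP: (x3_itv i) => h _; apply: lt_le_trans h; rewrite divr_gt0.
move=> s4 [s4_prep x4 e4 u4].
have x43 := eq_excess _ _ x4.
have sum4 : \sum_i excess alpha W (cells s4 ra_out) i <= 11 / 12 * \sum_i e i.
  rewrite (eq_bigr _ (fun i _ => x43 i)).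
  by apply: (sum_excess_iterate_lt alpha W _ _ _ e y) => //; rewrite -uE.
have u4E : rls s4 ra_excess 0%N = \sum_i excess alpha W (cells s4 ra_out) i.
  by rewrite u4; apply: eq_bigr => i _; rewrite x43.
split; last by rewrite u4E uE.
split=> //.
- by move=> i; rewrite x4.
- by move=> i; rewrite e4 x43.
apply: le_trans sum4 _; have : 0 <= \sum_i e i by rewrite sumr_ge0 // => i _; rewrite ltW.
lra.
Qed.

(** Each round multiplies the total excess by at most [11 / 12], so the exponent of [12 / 11] counts
    the rounds left; at exponent 0 the guard is false. *)
Lemma runs_iterations s k : valid s ->
  rls s ra_excess 0%N <= 3 * alpha * n%:R * (12 / 11) ^+ k ->
  runs solve good (While excess_large iteration) s
    (fun s' => valid s' /\ rls s' ra_excess 0%N <= 3 * alpha * n%:R)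
    ((bcost excess_large).+1
     + k * (bcost excess_large + (K + (T.+1 + (K + 5 * K)))).+1).
Proof.
move=> s_valid u_le.
have condE s' : valid s' ->
    beval s' excess_large = (3 * alpha * n%:R < rls s' ra_excess 0%N).
  by move=> [[[_ _ _ al _] _ _ dim _] _ _ _ _]; rewrite /= al dim.
pose I k s' := valid s' /\ rls s' ra_excess 0%N <= 3 * alpha * n%:R * (12 / 11) ^+ k.
apply: (runs_while _ _ I) => // [j s' [s'_valid le_u]|j s' [s'_valid le_u]].
  rewrite condE // => lt_u; case: j le_u => [|j] le_u.
    by rewrite expr0 mulr1 leNgt lt_u in le_u.
  exists j => //; apply: runs_weaken; first exact: runs_iteration.
    move=> s'' [s''_valid le_u'']; split=> //.
    by apply: (le_trans le_u''); move: le_u; rewrite exprS; lra.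
  by [].
by rewrite condE // -leNgt.
Qed.

Lemma loaded_input : loaded (input n es alpha).
Proof.
split=> [||k kes||k kes] //=; last by rewrite (nth_map (0%N, 0%N, 0)).
by split; rewrite (nth_map (0%N, 0%N, 0)).
Qed.

(** This loop writes two integer arrays, which [agree_off] excludes, so the general [runs_loop] is
    used with its own invariant. *)
Lemma runs_copy_pattern s : loaded s ->
  runs solve good copy_pattern s (fun s' => [/\ loaded s', rls s' = rls s &
    forall k, (k < size es)%N -> ints s' ia_qrow k = row k /\ ints s' ia_qcol k = col k])
  K.
Proof.
move=> s_load.
pose J k s' := [/\ forall b j, b \notin [:: ia_qrow; ia_qcol; ia_counter] ->
    ints s' b j = ints s b j, rls s' = rls s &
  forall j, (j < k)%N -> ints s' ia_qrow j = row j /\ ints s' ia_qcol j = col j].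
have [h0 h1 h2 h3 h4] := s_load.
apply: (@runs_weaken _ _ _ _ _ _ (J (size es)) _ K);
  first apply: (@runs_loop _ _ _ _ J _ _ _ 100).
- by move=> k s' [-> //].
- move=> k s' kes [hi hr hJ] ck; have [rk colk] := h2 _ kes.
  apply: (@runs_weaken _ _ _ _ _ _ _ _ (50 + 50)); last by [].
    apply: runs_seq; first exact: runs_iset.
    by move=> _ <-; exact: runs_iset.
  move=> _ <- /=; rewrite /update /= ck !hi // rk colk; split=> //; split=> //.
    move=> b j; rewrite !inE !negb_or => /and3P[b4 b5 b6].
    by rewrite /= /update (negPf b4) (negPf b5) (negPf b6) /= hi // !inE !negb_or b4 b5.
  move=> j; rewrite ltnS leq_eqVlt /= /update /=.
  by have [->|_ /hJ] := eqVneq j k.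
- split=> // b j; rewrite !inE !negb_or => /and3P[_ _ b6].
  by rewrite /= /update (negPf b6).
- move=> s' [hi hr hJ]; split=> //; split; rewrite ?hi ?hr //.
  by move=> k /h2; rewrite !hi.
- exact: leqnn.
Qed.

Lemma runs_prepare : runs solve good prepare (input n es alpha) valid
  (K + (100 + (K + (K + (100 + (K + 5 * K)))))).
Proof.
apply: runs_seq; first exact: runs_copy_pattern loaded_input.
move=> s1 [load1 rls1 pat1].
apply: runs_seq; first exact: runs_iset.
move=> s2 s2E.
have load2 : loaded s2.
  by rewrite -s2E; case: load1 => h0 h1 h2 h3 h4; split.
have pat2 : patterned s2.
  by rewrite -s2E; split; [case: load1 | ].
have rls2 b k : rls s2 b k = rls (input n es alpha) b k by rewrite -s2E /= rls1.
apply: runs_seq.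
  apply: (@runs_add ra_diag _ (size es) _ col
    (fun k => if row k == col k then val k else 0)) => //; first by case: load2.
  move=> k s' kes ag ck.
  have load' : loaded s' by apply: loaded_agree ag load2.
  apply: (@runs_if _ _ _ _ _ _ _ _ _ 60) => //; rewrite (on_diagonalE s' k) //.
  have [_ _ /(_ _ kes)[rk colk] _ /(_ _ kes) valk] := load'.
  by case: ifP => _; apply: runs_rset => //=; rewrite ck colk ?valk.
move=> s3 [ag3 diag3].
have load3 : loaded s3 by apply: loaded_agree ag3 load2.
have pat3 : patterned s3 by apply: patterned_agree ag3 pat2.
(* Scratch arrays start at 0, so the accumulated sum is the diagonal entry itself. *)
have diag3E (i : 'I_n) : rls s3 ra_diag i = L i i.
  rewrite diag3 rls2 /= nth_nil add0r -big_mkcondr -es_L -sum_entry.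
  apply: eq_bigl => k; rewrite -/row -/col andbC.
  by have [->|] := eqVneq (col k) i; rewrite ?andbF ?andbT.
apply: runs_seq.
  apply: (@runs_add ra_dim _ n _ (fun=> 0%N) (fun=> 1)) => //; first by case: load3.
  by move=> k s' kn ag ck; apply: runs_rset.
move=> s4 [ag4 dim4].
have load4 : loaded s4 by apply: loaded_agree ag4 load3.
have pat4 : patterned s4 by apply: patterned_agree ag4 pat3.
have dim4E : rls s4 ra_dim 0%N = n%:R.
  by rewrite dim4 ag3.2 // rls2 /= add0r big_mkord sumr_const card_ord.
apply: runs_seq; first exact: runs_rset.
move=> s5 s5E.
have ag5 : agree_off ra_qeps s4 s5.
  by rewrite -s5E; split=> // b k /negPf hb; rewrite /= /update hb.
have prep5 : prepared s5.
  split.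
  - by apply: loaded_agree ag5 load4.
  - by apply: patterned_agree ag5 pat4.
  - by move=> i; rewrite ag5.2 // ag4.2.
  - by rewrite ag5.2.
  - have al4 : rls s4 ra_alpha 0%N = alpha by case: load4.
    rewrite -s5E /update /= dim4E al4.
    by congr (_ / (_ * _)); ring.
apply: runs_seq.
  apply: (@runs_map ra_out _ n _ (fun=> 1)) => //; first by case: prep5 => -[].
  by move=> k s' kn ag _ ck; apply: runs_rset.
move=> s6 [ag6 x6].
have prep6 : prepared s6 by apply: prepared_agree ag6 prep5.
have x6E : cells s6 ra_out =1 (fun=> 1) by move=> i; rewrite /cells x6.
apply: runs_weaken; [apply: runs_compute_excess => // i | | by []].
  by rewrite x6E.
move=> s7 [prep7 x7 e7 u7].
have x7E i : cells s7 ra_out i = 1 by rewrite x7 x6E.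
have ex7 := eq_excess _ _ x7; have ex6 := eq_excess _ _ x6E.
have n1 := n_ge1; have [a0 a1] := andP alpha_itv.
split=> //.
- move=> i; rewrite x7E; apply/andP; split; first lra.
  by rewrite ler_pdivlMr //; lra.
- by move=> i; rewrite ex7.
- by rewrite u7; apply: eq_bigr => i _; rewrite ex7.
rewrite (eq_bigr (excess alpha W (fun=> 1))); last by move=> i _; rewrite ex7 ex6.
exact: sum_excess_one_le.
Qed.

Lemma runs_normalize s : prepared s ->
  runs solve good normalize s
    (fun s' => forall i, cells s' ra_out i = cells s ra_out i / \sum_j cells s ra_out j)
    (100 + (K + K)).
Proof.
move=> s_prep.
apply: runs_seq; first exact: runs_rset.
move=> s1 s1E.
have ag1 : agree_off ra_total s s1.
  by rewrite -s1E; split=> // b k /negPf hb; rewrite /= /update hb.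
have s1_prep : prepared s1 by apply: prepared_agree ag1 s_prep.
apply: runs_seq.
  apply: (@runs_add ra_total _ n _ (fun=> 0%N) (rls s ra_out)) => //.
    by case: s1_prep => -[].
  by move=> k s' kn ag ck; apply: runs_rset => //=; rewrite ck (ag.2 ra_out) // ag1.2.
move=> s2 [ag2 total2].
have s2_prep : prepared s2 by apply: prepared_agree ag2 s1_prep.
have total2E : rls s2 ra_total 0%N = \sum_j cells s ra_out j.
  by rewrite total2 -s1E /update /= add0r big_mkord.
apply: runs_weaken; [| |exact: leqnn].
  apply: (@runs_map ra_out _ n _
    (fun k => rls s ra_out k / \sum_j cells s ra_out j)) => //.
    by case: s2_prep => -[].
  move=> k s' kn ag out' ck; apply: runs_rset => //=.
  by rewrite ck out' (ag.2 ra_total) // total2E ag2.2 // ag1.2.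
by move=> s3 [_ out3] i; rewrite /cells out3.
Qed.

(** Each single excess is at most the total, hence at most [3 * alpha * n%:R]. The row condition is
    homogeneous in [x] and the ratio of bounds is scale-free, so dividing by the total is harmless;
    that ratio is [8 * (n%:R / alpha ^+ 2)]. *)
Lemma valid_output s (x : 'cV[R]_n) : valid s ->
  rls s ra_excess 0%N <= 3 * alpha * n%:R ->
  (forall i, x i 0 = cells s ra_out i / \sum_j cells s ra_out j) ->
  [/\ simplex x,
      rcdd alpha (((3 * alpha * n%:R) *: diag_part L + L) *m invmx (diag_part L)
                  *m diag_vec x)
    & (kappa (diag_vec x) <= (20 / alpha ^+ 2 * n%:R)%:E)%E].
Proof.
move=> [_ y_itv _ uE _]; set y := cells s ra_out in y_itv uE *.
rewrite {}uE => u_le xE; set tot := \sum_j y j in xE.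
have n1 := n_ge1; have a0 := alpha_gt0; have [_ a1] := andP alpha_itv.
have y_gt0 i : 0 < y i.
  by case/andP: (y_itv i) => h _; apply: lt_le_trans h; rewrite divr_gt0.
have tot_gt0 : 0 < tot.
  rewrite /tot (bigD1 (Ordinal n_gt0)) //= ltr_pwDl // sumr_ge0 // => i _.
  exact: ltW.
have x_ge0 i : 0 <= x i 0 by rewrite xE divr_ge0 // ltW.
split.
- split=> //; rewrite (eq_bigr (fun i => y i / tot)) // -mulr_suml divff //.
  exact: lt0r_neq0.
- rewrite shifted_scaled //; apply: rcdd_scaled => // [|i|i]; first exact: ltW.
    by have := ler_wpM2l (ltW a0) n1; lra.
  rewrite xE mulrA ler_pdivlMr //.
  have -> : (1 + alpha) * (\sum_j walk L i j * x j 0) * tot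
      = (1 + alpha) * \sum_j W i j * y j.
    rewrite -mulrA mulr_suml; congr (_ * _); apply: eq_bigr => j _.
    by rewrite xE mulrA divfK // lt0r_neq0.
  apply: le_trans (excess_row alpha W y i (y_gt0 i)) _.
  rewrite ler_wpM2r ?(ltW (y_gt0 i)) // lerD2l; apply: le_trans u_le.
  rewrite (bigD1 i) //= lerDl sumr_ge0 // => j _.
  by apply: le_trans (excess_ge _ _ _ _); exact: ltW.
apply: (@le_trans _ _ (((4 * n%:R / alpha / tot) / (alpha / 2 / tot))%:E)%E).
  apply: kappa_le => // [|i]; first by rewrite !divr_gt0.
  have /andP[lo hi] := y_itv i.
  rewrite !mxE eqxx mulr1n xE ger0_norm; last by rewrite divr_ge0 // ltW.
  by rewrite !ler_pM2r ?invr_gt0 // lo.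
rewrite lee_fin.
have -> : 4 * n%:R / alpha / tot / (alpha / 2 / tot) = 8 * (n%:R / alpha ^+ 2).
  by field; apply/andP; split; lra.
have -> : 20 / alpha ^+ 2 * n%:R = 20 * (n%:R / alpha ^+ 2) by field; lra.
by rewrite ler_wpM2r ?ler_nat // divr_ge0 // exprn_ge0 // ltW.
Qed.

(** [alpha^-1 > 2], and [expR (1 / 2) <= 2] follows from [expR (- (1 / 2)) >= 1 / 2]. Terms without
    a logarithm are absorbed by means of this bound. *)
Lemma ln_inv_ge : 1 / 2 <= ln alpha^-1.
Proof.
have a0 := alpha_gt0; have [_ a1] := andP alpha_itv.
rewrite -ler_expR lnK ?posrE ?invr_gt0 //.
apply: (@le_trans _ _ 2); last first.
  by rewrite -[2]invrK lef_pV2 ?posrE ?invr_gt0 //; lra.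
rewrite -[leLHS]invrK -expRN -[leRHS]invrK lef_pV2 ?posrE ?invr_gt0 ?expR_gt0 //.
by have := expR_ge1Dx (- (1 / 2) : R); lra.
Qed.

(** [expR (- (1 / 12)) >= 11 / 12] gives [expR (1 / 12) <= 12 / 11], so more than [12 * ln alpha^-1]
    rounds suffice; rounding up costs at most [2 * ln alpha^-1] more. *)
Lemma iteration_count : exists k : nat,
  k%:R <= 14 * ln alpha^-1 /\ alpha^-1 <= (12 / 11) ^+ k.
Proof.
have a0 := alpha_gt0; have [_ a1] := andP alpha_itv.
have ln_ge := ln_inv_ge.
exists (Num.truncn (12 * ln alpha^-1)).+1; split.
  have : (Num.truncn (12 * ln alpha^-1))%:R <= 12 * ln alpha^-1.
    by rewrite truncn_le //; lra.
  by rewrite -natr1; lra.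
set k := (Num.truncn _).+1; have k_gt : 12 * ln alpha^-1 < k%:R by exact: truncnS_gt.
rewrite -[leLHS](@lnK R) ?posrE ?invr_gt0 //.
apply: (@le_trans _ _ (sequences.expR (k%:R * (1 / 12)))); first by rewrite ler_expR; lra.
rewrite expRM_natl ler_pXn2r ?nnegrE ?expR_ge0 //; last by lra.
rewrite -[leLHS]invrK -expRN -[leRHS]invrK lef_pV2 ?posrE ?invr_gt0 ?expR_gt0 //; last by lra.
by have := expR_ge1Dx (- (1 / 12) : R); lra.
Qed.


Definition balanced (x : 'cV[R]_n) : Prop :=
  [/\ simplex x,
      rcdd alpha (((3 * alpha * n%:R) *: diag_part L + L) *m invmx (diag_part L)
                  *m diag_vec x)
    & (kappa (diag_vec x) <= (20 / alpha ^+ 2 * n%:R)%:E)%E].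

Lemma runs_scaling_program k : alpha^-1 <= (12 / 11) ^+ k ->
  runs solve good scaling_program (input n es alpha)
    (fun s => balanced (read_vec n s ra_out))
    (11 * K + 311 + k * (7 * K + T + 12)).
Proof.
move=> k_ge; have -> : (11 * K + 311 + k * (7 * K + T + 12)
    = K + (100 + (K + (K + (100 + (K + 5 * K)))))
      + ((bcost excess_large).+1
         + k * (bcost excess_large + (K + (T.+1 + (K + 5 * K)))).+1
         + (100 + (K + K))))%N.
  have -> : bcost excess_large = 10%N by [].
  have -> : (10 + (K + (T.+1 + (K + 5 * K)))).+1 = (7 * K + T + 12)%N by lia.
  by lia.
apply: runs_seq; first exact: runs_prepare.
move=> s s_valid; apply: runs_seq.
  apply: (runs_iterations s k) => //.
  case: s_valid => _ _ _ -> u_le; apply: (le_trans u_le).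
  have a0 := alpha_gt0.
  (* The initial excess exceeds the target by a factor of at most [alpha^-1], which [k] rounds
     remove. *)
  have -> : 3 * n%:R = 3 * alpha * n%:R * alpha^-1 by field; lra.
  by rewrite ler_wpM2l // !mulr_ge0 // ltW.
move=> s' [s'_valid u_le]; apply: runs_weaken.
- by apply: runs_normalize; case: s'_valid.
- by move=> s'' xE; apply: (valid_output s') => // i; rewrite mxE -xE.
- by [].
Qed.

(** With [m = nnz L], [size es <= m] and [1 <= m] give [K <= 224 * m]; then [1 <= 2 * ln alpha^-1]
    absorbs the cost outside the rounds. *)
Lemma scaling_program_time k : k%:R <= 14 * ln alpha^-1 ->
  (11 * K + 311 + k * (7 * K + T + 12))%N%:R
  <= (200 * 200)%N%:R * ((nnz L)%:R + T%:R) * ln alpha^-1.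
Proof.
move=> k_le; have l_ge := ln_inv_ge; set l := ln _ in k_le l_ge *.
have m_ge : 1 <= (nnz L)%:R :> R.
  by rewrite ler1n; apply: leq_trans n_gt0 _; exact: nnz_laplacian_ge.
have es_le : (size es)%:R <= (nnz L)%:R :> R.
  by rewrite ler_nat -es_L; exact: size_coo_le.
have K_le : K%:R <= 224 * (nnz L)%:R :> R.
  by rewrite natrM -natr1; lra.
move: (K) K_le => K0 K_le.
rewrite !(natrD, natrM).
set m := (nnz L)%:R in m_ge es_le K_le *.
have KT_ge0 : 0 <= 7 * K0%:R + T%:R + 12 :> R by rewrite !addr_ge0 ?mulr_ge0.
have kKT : k%:R * (7 * K0%:R + T%:R + 12) <= 14 * l * (1580 * m + T%:R).
  apply: ler_pM => //; lra.
have ml : m <= 2 * l * m by rewrite ler_peMl //; lra.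
have : 0 <= T%:R * l by rewrite mulr_ge0 //; lra.
by lra.
Qed.

End Correctness.

Theorem theorem3p1 (R : realType) :
  exists (P : cmd) (C_nnz C_eps d_eps C_time C_cond d_cond : nat),
  forall (n m : nat) (alpha : R) (L : 'M[R]_n) (es : coo R)
         (solve : procedure R n) (T : nat),
  let D := diag_part L in
  let N := (C_nnz * m)%N in
  let B := C_eps%:R * (n%:R / alpha) ^+ d_eps in
  (0 < n)%N ->
  0 < alpha < 1 / 2 ->
  directed_laplacian L ->
  nnz L = m ->
  (forall i, 0 < L i i) ->
  coo_wf n es -> coo_mx n es = L ->
  rcdd_solver alpha N B T solve ->
  exists (fin : memory R) (time : nat) (calls : seq (query R n)),
    let s := read_vec n fin ra_out in
    let S := diag_vec s in
    [/\ exec solve P (input n es alpha) fin time calls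
          /\ time%:R <= C_time%:R * (m%:R + T%:R) * ln (alpha^-1),
        simplex s,
        rcdd alpha (((3 * alpha * n%:R) *: D + L) *m invmx D *m S),
        (kappa S <= (20 / alpha ^+ 2 * n%:R)%:E)%E
      & List.Forall (fun q =>
          admissible alpha N B q
          /\ (kappa (diag_part (q_mx q))
                <= (C_cond%:R * (n%:R / alpha) ^+ d_cond)%:E)%E) calls].
Proof.
(* Queries have no more nonzero entries than [L], whence 1; [540] and 4 bound the inverse accuracy,
   [32] and 2 the condition numbers. *)
exists scaling_program, 1%N, 540%N, 4%N, (200 * 200)%N, 32%N, 2%N.
move=> n m alpha L es solve T; cbv zeta.
move=> n_gt0 alpha_itv L_lap <- L_diag es_wf es_L solve_spec.
have [k [k_le k_ge]] := iteration_count alpha alpha_itv.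
have [fin [time [calls [exec_fin time_le [x_simplex x_rcdd x_kappa] good_calls]]]] :=
  runs_scaling_program alpha L es solve T n_gt0 alpha_itv L_lap L_diag es_wf es_L
    solve_spec k k_ge.
exists fin, time, calls; split=> //; split=> //.
have := scaling_program_time alpha L es T n_gt0 alpha_itv L_diag es_wf es_L k k_le.
by apply: le_trans; rewrite ler_nat.
Qed.
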